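(* Let $u_l,u_r\in\mathbb{R}$ and $\rho_l,\rho_r>0$ with $u_l\le u_r$. For all sufficiently small $\epsilon>0$ let $(u^\epsilon,\rho^\epsilon)$ be the Riemann solution (described in the context) of $$u_t+\Big(\frac{u^2}{2}+\epsilon p(\rho)\Big)_x=0,\quad \rho_t+(\rho u)_x=0,\quad (u,\rho)(x,0)=\begin{cases}(u_l,\rho_l), & x<0,\\ (u_r,\rho_r), & x>0.\end{cases}$$ Then, as $\epsilon\to0$, $(u^\epsilon,\rho^\epsilon)$ converges in the sense of distributions on $\mathbb{R}\times(0,\infty)$ to $(u,\rho)$, where: (1) if $u_l=u_r$, then $u\equiv u_l$, and $\rho(x,t)=\rho_l$ for $x<u_lt$, $\rho(x,t)=\rho_r$ for $x>u_lt$; (2) if $u_l<u_r$, then $$u(x,t)=\begin{cases}u_l, & x<u_lt,\\ x/t, & u_lt<x<u_rt,\\ u_r, & x>u_rt,\end{cases}\qquad \rho(x,t)=\begin{cases}\rho_l, & x<u_lt,\\ 0, & u_lt<x<u_rt,\\ \rho_r, & x>u_rt.\end{cases}$$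
   Context: Here $p(\rho)=\int_0^\rho \frac{q'(\xi)}{\xi}\,d\xi$ with $q(\rho)=\int_0^\rho \xi^2 e^{\xi}\,d\xi$, i.e. $p(\rho)=\int_0^\rho \xi e^{\xi}\,d\xi$. The eigenvalues of the system are $\lambda_1(u,\rho)=u-\sqrt{\epsilon p'(\rho)\rho}$ and $\lambda_2(u,\rho)=u+\sqrt{\epsilon p'(\rho)\rho}$. Admissible shocks: a left state $(\bar u,\bar\rho)$ is connected to a different right state $(u,\rho)$ by a shock of speed $s$ if $s(u-\bar u)=(\frac{u^2}{2}+\epsilon p(\rho))-(\frac{\bar u^2}{2}+\epsilon p(\bar\rho))$ and $s(\rho-\bar\rho)=\rho u-\bar\rho\bar u$. It is a 1-shock if $s<\lambda_1(\bar u,\bar\rho)$ and $\lambda_1(u,\rho)<s<\lambda_2(u,\rho)$; it is a 2-shock if $s>\lambda_2(u,\rho)$ and $\lambda_1(\bar u,\bar\rho)<s<\lambda_2(\bar u,\bar\rho)$. Rarefactions: a 1-rarefaction (resp. 2-rarefaction) wave is a continuous self-similar solution, function of $x/t$, with $\lambda_1=x/t$ (resp. $\lambda_2=x/t$), whose values lie on a curve $\frac{du}{d\rho}=-\sqrt{\epsilon p'(\rho)/\rho}$ with $\rho$ decreasing from left to right (resp. $\frac{du}{d\rho}=\sqrt{\epsilon p'(\rho)/\rho}$ with $\rho$ increasing from left to right). Riemann solution for $u_l=u_r$: the constant solution if $\rho_l=\rho_r$; if $\rho_r<\rho_l$, the self-similar solution in which $(u_l,\rho_l)$ is joined by a 1-rarefaction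 to an intermediate state $(u^*_\epsilon,\rho^*_\epsilon)$, which is joined by a 2-shock to $(u_r,\rho_r)$; if $\rho_l<\rho_r$, the self-similar solution in which $(u_l,\rho_l)$ is joined by a 1-shock to an intermediate state $(u^*_\epsilon,\rho^*_\epsilon)$, which is joined by a 2-rarefaction to $(u_r,\rho_r)$. Riemann solution for $u_l<u_r$ and $\epsilon$ small: $(u_l,\rho_l)$ is joined by a 1-rarefaction to the vacuum state $(u^{*(1)}_\epsilon,0)$, where $u^{*(1)}_\epsilon=u_l+\int_0^{\rho_l}\sqrt{\epsilon p'(\xi)/\xi}\,d\xi$; the vacuum state $(u^{*(2)}_\epsilon,0)$, where $u^{*(2)}_\epsilon=u_r-\int_0^{\rho_r}\sqrt{\epsilon p'(\xi)/\xi}\,d\xi$, is joined by a 2-rarefaction to $(u_r,\rho_r)$; and in the region $u^{*(1)}_\epsilon t<x<u^{*(2)}_\epsilon t$ one sets $\rho^\epsilon=0$ and $u^\epsilon=x/t$. *)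

(* Defs.v *)
From HB Require Import structures.
From mathcomp Require Import all_boot all_order all_algebra.
From mathcomp Require Import all_classical all_reals all_analysis.
Set Implicit Arguments.
Unset Strict Implicit.
Unset Printing Implicit Defensive.
Import Order.TTheory GRing.Theory Num.Theory.
Import numFieldNormedType.Exports.
Local Open Scope classical_set_scope.
Local Open Scope ring_scope.

Section System.
Context {R : realType}.

(* Densities are nonnegative throughout: the integrals below run over `[0, r],
   which is empty for r < 0. *)
Definition qflux (r : R) : R :=
  \int[lebesgue_measure]_(xi in `[0, r]) (xi ^+ 2 * expR xi).

Definition pressure (r : R) : R :=
  \int[lebesgue_measure]_(xi in `[0, r]) (derive1 qflux xi / xi).

(* A state is a pair (velocity, density). *)
Definition state : Type := (R * R)%type.

Definition lambda1 (eps : R) (U : state) : R :=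
  U.1 - Num.sqrt (eps * derive1 pressure U.2 * U.2).

Definition lambda2 (eps : R) (U : state) : R :=
  U.1 + Num.sqrt (eps * derive1 pressure U.2 * U.2).

Definition flux (eps u rho : R) : R := u ^+ 2 / 2 + eps * pressure rho.

(* Functions of space and time are written u x t. *)
Definition solves_system_at (eps : R) (u rho : R -> R -> R) (x t : R) : Prop :=
  [/\ derivable (u x) t 1 /\ derivable (fun y => u y t) x 1,
      derivable (rho x) t 1 /\ derivable (fun y => rho y t) x 1,
      derive1 (u x) t + derive1 (fun y => flux eps (u y t) (rho y t)) x = 0 &
      derive1 (rho x) t + derive1 (fun y => rho y t * u y t) x = 0].

Definition rankine_hugoniot (eps : R) (U V : state) (s : R) : Prop :=
  s * (V.1 - U.1) = flux eps V.1 V.2 - flux eps U.1 U.2 /\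
  s * (V.2 - U.2) = V.2 * V.1 - U.2 * U.1.

(* U is the left state, V the right state. *)
Definition shock1 (eps : R) (U V : state) (s : R) : Prop :=
  [/\ U <> V, rankine_hugoniot eps U V s,
      s < lambda1 eps U & lambda1 eps V < s < lambda2 eps V].

Definition shock2 (eps : R) (U V : state) (s : R) : Prop :=
  [/\ U <> V, rankine_hugoniot eps U V s,
      lambda2 eps V < s & lambda1 eps U < s < lambda2 eps U].

Definition on_curve (slope : R -> R) (W : R -> state) (a b : R) : Prop :=
  exists g : R -> R,
    [/\ {within `[0, +oo[, continuous g},
        forall r : R, 0 < r -> is_derive r 1 g (slope r) &
        forall xi, a <= xi <= b -> (W xi).1 = g (W xi).2].

(* The part of the profile W, a function of xi = x / t, carried by the fan
   lambda U <= xi <= lambda V is a continuous self-similar solution from U to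
   V.  The system is required to hold in the open fan, since the profile has
   corners on its edges. *)
Definition fan (eps : R) (lambda : state -> R) (slope : R -> R) (U V : state)
    (W : R -> state) : Prop :=
  let a := lambda U in let b := lambda V in
  [/\ a < b /\ {within `[a, b], continuous W},
      W a = U /\ W b = V,
      forall xi, a <= xi <= b -> lambda (W xi) = xi,
      forall x t, 0 < t -> a < x / t < b ->
        solves_system_at eps (fun y s => (W (y / s)).1)
          (fun y s => (W (y / s)).2) x t &
      on_curve slope W a b].

Definition rarefaction1 (eps : R) (U V : state) (W : R -> state) : Prop :=
  fan eps (lambda1 eps) (fun r => - Num.sqrt (eps * derive1 pressure r / r)) U V W /\
  forall xi eta, lambda1 eps U <= xi -> xi < eta -> eta <= lambda1 eps V ->
    (W eta).2 < (W xi).2.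

Definition rarefaction2 (eps : R) (U V : state) (W : R -> state) : Prop :=
  fan eps (lambda2 eps) (fun r => Num.sqrt (eps * derive1 pressure r / r)) U V W /\
  forall xi eta, lambda2 eps U <= xi -> xi < eta -> eta <= lambda2 eps V ->
    (W xi).2 < (W eta).2.

Definition vacuum1 (eps : R) (U : state) : R :=
  U.1 + \int[lebesgue_measure]_(xi in `[0, U.2])
    Num.sqrt (eps * derive1 pressure xi / xi).

Definition vacuum2 (eps : R) (U : state) : R :=
  U.1 - \int[lebesgue_measure]_(xi in `[0, U.2])
    Num.sqrt (eps * derive1 pressure xi / xi).

(* The value of the profile at a shock speed is left unspecified.  In the last
   case, vacuum1 < vacuum2 is the smallness condition on eps. *)
Inductive riemann_profile (eps : R) (Ul Ur : state) (W : R -> state) : Prop :=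
| riemann_constant of
    Ul.1 = Ur.1 & Ul.2 = Ur.2 & (forall xi, W xi = Ul)
| riemann_rarefaction_shock (Um : state) (s : R) of
    Ul.1 = Ur.1 & Ur.2 < Ul.2 & 0 <= Um.2 &
    rarefaction1 eps Ul Um W & shock2 eps Um Ur s &
    (forall xi, xi < lambda1 eps Ul -> W xi = Ul) &
    (forall xi, lambda1 eps Um < xi < s -> W xi = Um) &
    (forall xi, s < xi -> W xi = Ur)
| riemann_shock_rarefaction (Um : state) (s : R) of
    Ul.1 = Ur.1 & Ul.2 < Ur.2 & 0 <= Um.2 &
    shock1 eps Ul Um s & rarefaction2 eps Um Ur W &
    (forall xi, xi < s -> W xi = Ul) &
    (forall xi, s < xi < lambda2 eps Um -> W xi = Um) &
    (forall xi, lambda2 eps Ur < xi -> W xi = Ur)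
| riemann_vacuum of
    Ul.1 < Ur.1 & vacuum1 eps Ul < vacuum2 eps Ur &
    rarefaction1 eps Ul (vacuum1 eps Ul, 0) W &
    rarefaction2 eps (vacuum2 eps Ur, 0) Ur W &
    (forall xi, xi < lambda1 eps Ul -> W xi = Ul) &
    (forall xi, vacuum1 eps Ul < xi < vacuum2 eps Ur -> W xi = (xi, 0)) &
    (forall xi, lambda2 eps Ur < xi -> W xi = Ur).

Definition riemann_solution (eps : R) (Ul Ur : state) (u rho : R -> R -> R) :
    Prop :=
  exists2 W : R -> state, riemann_profile eps Ul Ur W &
    forall x t, 0 < t -> u x t = (W (x / t)).1 /\ rho x t = (W (x / t)).2.

End System.

Section Distributions.
Context {R : realType}.

Definition half_plane : set (R * R) := [set z | 0 < z.2].

Fixpoint Ck (k : nat) (phi : R * R -> R) : Prop :=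
  if k is k'.+1 then
    [/\ continuous phi,
        forall z, derivable phi z (1, 0) /\ derivable phi z (0, 1),
        Ck k' ('D_(1, 0) phi) & Ck k' ('D_(0, 1) phi)]
  else continuous phi.

(* Elements of C_c^oo(half_plane), extended by 0 to the whole plane. *)
Definition test_function (phi : R * R -> R) : Prop :=
  [/\ forall k, Ck k phi,
      compact (closure [set z | phi z != 0]) &
      closure [set z | phi z != 0] `<=` half_plane].

Local Notation lebesgue2 := (@lebesgue_measure R \x @lebesgue_measure R)%E.

(* Such an f defines a distribution on half_plane. *)
Definition locally_integrable2 (f : R -> R -> R) : Prop :=
  measurable_fun half_plane (fun z : R * R => f z.1 z.2) /\
  forall K : set (R * R), K `<=` half_plane -> compact K ->
    (\int[lebesgue2]_(z in K) `|f z.1 z.2|%:E < +oo)%E.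

Definition pairing (f : R -> R -> R) (phi : R * R -> R) : R :=
  \int[lebesgue2]_(z in half_plane) (f z.1 z.2 * phi z).

(* Convergence in the sense of distributions on half_plane as eps -> 0+. *)
Definition distribution_cvg (f : R -> R -> R -> R) (g : R -> R -> R) : Prop :=
  [/\ \forall eps \near 0^'+, locally_integrable2 (f eps),
      locally_integrable2 g &
      forall phi, test_function phi ->
        pairing (f eps) phi @[eps --> 0^'+] --> pairing g phi].

End Distributions.

Section Limits.
Context {R : realType}.

(* The values chosen on the two rays x = ul * t and x = ur * t, a null set, do
   not matter. *)
Definition jump_density (v rl rr x t : R) : R := if x < v * t then rl else rr.

Definition fan_velocity (ul ur x t : R) : R :=
  if x < ul * t then ul else if x <= ur * t then x / t else ur.

Definition vacuum_density (ul ur rl rr x t : R) : R :=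
  if x < ul * t then rl else if x <= ur * t then 0 else rr.

End Limits.

(* Main.v *)
Require Import Defs.
From HB Require Import structures.
From mathcomp Require Import all_boot all_order all_algebra.
From mathcomp Require Import all_classical all_reals all_analysis.
From mathcomp Require Import measurable_realfun ring lra.
Set Implicit Arguments.
Unset Strict Implicit.
Unset Printing Implicit Defensive.
Import Order.TTheory GRing.Theory Num.Theory.
Import numFieldNormedType.Exports.
Local Open Scope classical_set_scope.
Local Open Scope ring_scope.

(** Everything happens on the scale of the sound speed.  For a density r >= 0
    the pressure is (r - 1) e^r + 1, so that sqrt(eps p'(r) r) is
    sqrt(eps) r e^(r/2): wherever the density stays below a fixed m, the
    characteristic speeds differ from the velocity by at most
    [max_sound_speed eps m], which is a constant times sqrt(eps).

    Limit.  Along a rarefaction the density is monotone, hence bounded by the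
    two initial densities, and the velocity varies by at most
    [max_sound_speed eps m] because the slope of the rarefaction curve is
    sqrt(eps) e^(r/2) in absolute value.  A shock speed lies between two
    characteristic speeds by the Lax inequalities.  So every wave of a Riemann
    solution is confined to rays x / t at distance O(sqrt(eps)) from ul or from
    ur ([riemann_profile_location]).  Off the two rays x = ul t and x = ur t the solution is
    therefore equal to its limit as soon as eps is small, it is uniformly
    bounded off one more ray (that of the shock), and dominated convergence
    applies since rays are null sets ([ray_profile_cvg]).

    Existence.  A wave of the family of sign sg = 1 or -1 follows the curve
    u = u0 + 2 sg sqrt(eps) e^(r/2), on which the characteristic speed is
    u0 + sg sqrt(eps) (2 + r) e^(r/2).  The function (2 + r) e^(r/2) increases,
    and its inverse gives the rarefaction fan ([simple_wave_fan]), including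
    the fans that reach the vacuum.  For a shock between the densities r < m,
    Cauchy's mean value theorem applied to p and to the square function gives
    c in (r, m) with p(m) - p(r) = e^c (m^2 - r^2) / 2, and then the velocity
    jump is sqrt(eps) e^(c/2) (m - r); the Lax inequalities
    reduce to r < c < m.  Joining a shock and a rarefaction amounts to the
    equation 2 (e^(s/2) - e^(m/2)) = e^(c/2) (m - r), in which eps does not
    occur; the intermediate value theorem solves it ([middle_density]). *)

(** * Borel sets and null rays of the plane *)

(** The product sigma-algebra contains the open sets of the plane, because an
    open set is the union of the countably many rational open rectangles that
    it contains. *)
Lemma open_measurable2 (R : realType) (U : set (R * R)) :
  open U -> measurable U.
Proof.
move=> oU.
pose box (p : rat * rat * (rat * rat)) : set (R * R) :=
  (`]ratr p.1.1, ratr p.1.2[ `*` `]ratr p.2.1, ratr p.2.2[)%classic.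
have -> : U = \bigcup_p (if `[< box p `<=` U >] then box p else set0).
  apply/seteqP; split=> [[x y] Uxy|z [p _]]; last by case: asboolP => // + bz; exact.
  have [e e0 eU] : exists2 e : R, 0 < e & ball (x, y) e `<=` U.
    have /nbhs_ballP[e /= e0 eU] := open_nbhs_nbhs (conj oU Uxy).
    by exists e.
  have rb (v : R) : exists p : rat * rat, ratr p.1 < v < ratr p.2 /\
      forall w, ratr p.1 < w < ratr p.2 -> ball v e w.
    have [|q1] := @rat_in_itvoo _ (v - e) v; first lra.
    have [|q2] := @rat_in_itvoo _ v (v + e); first lra.
    rewrite !in_itv/= => /andP[a1 a2] /andP[a3 a4].
    exists (q1, q2) => /=; split; first by rewrite a4 a1.
    move=> w /andP[a5 a6]; rewrite /ball/= ltr_norml; lra.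
  have [p [xp px]] := rb x; have [q [yq qy]] := rb y.
  exists (p, q) => //; case: asboolP => [_|]; first by split; rewrite /= in_itv.
  case=> -[v w] [/=]; rewrite !in_itv/= => /px bv /qy bw.
  by apply: eU; split.
apply: countable_bigcupT_measurable => // p; case: asboolP => // _.
exact: measurableX.
Qed.

Lemma continuous_measurable_fun2 (R : realType) (f : R * R -> R) :
  continuous f -> measurable_fun setT f.
Proof.
move=> /continuousP cf; apply: (measurability _ (RGenOpens.measurableE R)).
move=> _ [_ [a [b ->] <-]]; rewrite setTI; apply: open_measurable2.
exact/cf/interval_open.
Qed.

Local Notation leb2 R := (@lebesgue_measure R \x @lebesgue_measure R)%E.

Lemma measurable_half_plane (R : realType) : measurable (@half_plane R).
Proof.
have -> : @half_plane R = (snd : R * R -> R) @^-1` `]0, +oo[%classic.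
  by apply/seteqP; split=> z /=; rewrite in_itv/= andbT.
rewrite -[X in measurable X]setTI.
by apply: measurable_snd => //; exact: measurable_itv.
Qed.

Definition square (R : realType) (A : R) : set (R * R) :=
  `[- A, A] `*` `[- A, A].

Lemma compact_subsquare (R : realType) (K : set (R * R)) : compact K ->
  exists A : R, K `<=` square A.
Proof.
move=> /compact_bounded[A [_ bA]]; exists (A + 1) => z Kz.
have : `|z| <= A + 1 by apply: bA => //; lra.
rewrite prod_normE ge_max => /andP[/ler_normlP[z1 z2] /ler_normlP[z3 z4]].
by split; rewrite /= in_itv/=; lra.
Qed.

Lemma square_lty (R : realType) (A : R) :
  (leb2 R (square A) < +oo)%E.
Proof.
rewrite product_measure1E//= !lebesgue_measure_itv/=.
by case: ifP => _; rewrite -?EFinD -?EFinM ?mule0 ltry.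
Qed.

Lemma compact_measurable2 (R : realType) (K : set (R * R)) :
  compact K -> measurable K.
Proof.
move=> /compact_closed cK; rewrite -(setCK K); apply: measurableC.
by apply: open_measurable2; apply: closed_openC; apply: cK; exact: norm_hausdorff.
Qed.

Lemma compact_lty2 (R : realType) (K : set (R * R)) :
  compact K -> (leb2 R K < +oo)%E.
Proof.
move=> cK; have [A KA] := compact_subsquare cK.
apply: le_lt_trans (square_lty A); apply: le_measure => //; rewrite inE.
  exact: compact_measurable2.
exact: measurableX.
Qed.

Lemma measurable_ray (R : realType) (s : R) :
  measurable [set z : R * R | z.1 = s * z.2].
Proof.
have -> : [set z : R * R | z.1 = s * z.2] =
    (fun z : R * R => z.1 - s * z.2) @^-1` [set 0].
  by apply/seteqP; split=> z /= => [->|/subr0_eq//]; rewrite subrr.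
rewrite -[X in measurable X]setTI; apply: (_ : measurable_fun _ _) => //.
apply: measurable_funB; first exact: measurable_fst.
by apply: measurable_funM; [exact: measurable_cst|exact: measurable_snd].
Qed.

(** Integrating first along the horizontal lines, each of which meets the ray
    in one point, gives measure zero. *)
Lemma ray_negligible (R : realType) (s : R) :
  (leb2 R).-negligible [set z : R * R | z.1 = s * z.2].
Proof.
apply/negligibleP; first exact: measurable_ray.
apply: etrans (product_measure_unique
  (m' := (@lebesgue_measure R \x^ @lebesgue_measure R)%E) _ (measurable_ray s)) _.
  by move=> A B mA mB; exact: product_measure2E.
apply: integral0_eq => t _ /=.
have -> : ysection [set z : R * R | z.1 = s * z.2] t = [set s * t].
  by apply/seteqP; split=> x; rewrite /ysection/= inE.
exact: lebesgue_measure_set1.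
Qed.

Lemma bounded_locally_integrable2 (R : realType) (B : R) (f : R -> R -> R) :
  measurable_fun half_plane (fun z : R * R => f z.1 z.2) ->
  (forall x t, 0 < t -> `|f x t| <= B) -> locally_integrable2 f.
Proof.
move=> mf fB; split=> // K KH cK; have mK := compact_measurable2 cK.
have mfK : measurable_fun K (fun z : R * R => f z.1 z.2).
  by apply: measurable_funS mf => //; exact: measurable_half_plane.
apply: (@le_lt_trans _ _ (\int[leb2 R]_(z in K) (cst B%:E) z)%E).
  apply: ge0_le_integral => //=.
  - by apply/measurable_EFinP; exact: measurableT_comp.
  - by move=> z Kz; rewrite lee_fin; apply: fB (KH _ Kz).
have /= -> := integral_cst (leb2 R) mK B%:E; rewrite lte_mul_pinfty ?compact_lty2//.
by rewrite lee_fin (le_trans (normr_ge0 _) (fB 0 1 ltr01)).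
Qed.

(** * Convergence of ray-wise eventually constant functions *)

Lemma test_function_continuous (R : realType) (phi : R * R -> R) :
  test_function phi -> continuous phi.
Proof. by case=> /(_ 0%N). Qed.

(** The right-hand side, times a bound for the solutions, dominates the
    integrands of the pairings. *)
Lemma test_function_le_indic (R : realType) (phi : R * R -> R) :
  test_function phi ->
  exists A C : R, 0 <= C /\ forall z, `|phi z| <= C * \1_(square A) z.
Proof.
move=> tphi; have cphi := test_function_continuous tphi.
case: tphi => _ cS _; set S := closure _ in cS.
have [A SA] := compact_subsquare cS.
have /compact_bounded[C [_ bC]] : compact (phi @` S).
  apply: continuous_compact cS; exact: continuous_subspaceT.
exists A, (`|C| + 1); split=> [|z]; first by rewrite addr_ge0.
have [Sz|nSz] := pselect (S z).
  rewrite indicE mem_set ?mulr1; last exact: SA.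
  apply: bC; last by exists z.
  by rewrite (le_lt_trans (ler_norm _))// ltrDl.
have -> : phi z = 0.
  by apply/eqP; apply: contrapT => /negP pz; apply: nSz; exact: subset_closure.
by rewrite normr0 mulr_ge0// addr_ge0.
Qed.

Lemma integrable_square (R : realType) (A : R) (D : set (R * R)) :
  measurable D ->
  (leb2 R).-integrable D (fun z => (\1_(square A) z)%:E).
Proof.
move=> mD; have mS : measurable (square A) by exact: measurableX.
apply: (@integrableS _ _ _ _ setT) => //.
apply/integrableP; split; first exact/measurable_EFinP/measurable_indic.
under eq_integral do rewrite gee0_abs ?lee_fin//.
by rewrite integral_indic// setIT square_lty.
Qed.

(** The convergence principle for functions that settle down on each ray
    x / t = const: pointwise equality with the limit off two rays, for eps small
    depending on the point, and a bound M uniform in eps.  The bound M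
    may fail on one ray depending on eps, where a shock leaves the solution
    unspecified; there any finite bound B, depending on eps, is enough for
    local integrability. *)
Lemma ray_profile_cvg (R : realType) (a b M : R) (f : R -> R -> R -> R)
    (g : R -> R -> R) :
  (\forall eps \near 0^'+,
     measurable_fun half_plane (fun z : R * R => f eps z.1 z.2) /\
     exists s B : R, forall x t, 0 < t ->
       `|f eps x t| <= B /\ (x <> s * t -> `|f eps x t| <= M)) ->
  measurable_fun half_plane (fun z : R * R => g z.1 z.2) ->
  (forall x t, 0 < t -> `|g x t| <= M) ->
  (forall x t, 0 < t -> x <> a * t -> x <> b * t ->
     \forall eps \near 0^'+, f eps x t = g x t) ->
  distribution_cvg f g.
Proof.
move=> nf mg gM fg; have mH := @measurable_half_plane R.
split; first 2 last.
- move=> phi tphi; have cphi := test_function_continuous tphi.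
  have [A [C [C0 phiC]]] := test_function_le_indic tphi.
  have mphi : measurable_fun (@half_plane R) phi.
    by apply: measurable_funTS; exact: continuous_measurable_fun2.
  apply/cvg_at_rightP => u [u0 cu].
  have {}cu : u n @[n --> \oo] --> 0^'+.
    by move=> P /cu; rewrite /nbhs/=; apply: filterS => n; apply; exact: u0.
  (* Only the tail of the sequence is known to satisfy the hypotheses, so the
     dominated convergence theorem is applied to a shifted sequence. *)
  have [N _ NP] := cu _ nf.
  rewrite -(cvg_shiftn N).
  pose v n := u (n + N)%N.
  have cv : v n @[n --> \oo] --> 0^'+ by rewrite /v (cvg_shiftn N).
  have vP n := NP (n + N)%N (leq_addl _ _).
  have {vP} [mv /choice[s sP]] : (forall n,
      measurable_fun half_plane (fun z : R * R => f (v n) z.1 z.2)) /\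
      forall n, exists s : R, forall x t, 0 < t -> x <> s * t ->
        `|f (v n) x t| <= M.
    split=> n; first by have [] := vP n.
    have [_ [s [B sB]]] := vP n; exists s => x t t0; exact: (sB _ _ t0).2.
  have M0 : 0 <= M by apply: le_trans (gM 0 1 ltr01).
  have mfn n : measurable_fun (@half_plane R)
      (fun z : R * R => (f (v n) z.1 z.2 * phi z)%:E).
    by apply/measurable_EFinP; apply: measurable_funM.
  have mgn : measurable_fun (@half_plane R)
      (fun z : R * R => (g z.1 z.2 * phi z)%:E).
    by apply/measurable_EFinP; apply: measurable_funM.
  have cvfg : \forall z \ae leb2 R, half_plane z ->
      (f (v n) z.1 z.2 * phi z)%:E @[n --> \oo] --> (g z.1 z.2 * phi z)%:E.
    have := negligibleU (ray_negligible a) (ray_negligible b).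
    apply: negligibleS => z /= nz; apply: contrapT => nab; apply: nz => z0.
    apply: cvg_near_cst; have /cv : \forall eps \near 0^'+, f eps z.1 z.2 = g z.1 z.2.
      by apply: fg => // ?; apply: nab; [left|right].
    by rewrite /nbhs/=; apply: filterS => n /= ->.
  have idom : (leb2 R).-integrable half_plane
      (fun z => ((M * C)%:E * (\1_(square A) z)%:E)%E).
    apply: integrableZl => //; exact: integrable_square.
  have ledom : \forall z \ae leb2 R, forall n, half_plane z ->
      (`|(f (v n) z.1 z.2 * phi z)%:E| <= (M * C)%:E * (\1_(square A) z)%:E)%E.
    apply: ae_foralln => n; have := ray_negligible (s n).
    apply: negligibleS => z /= nz; apply: contrapT => ns; apply: nz => z0.
    rewrite -EFinM lee_fin normrM -mulrA.
    by apply: ler_pM => //; apply: sP.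
  have [ig _ cg] := dominated_convergence (mu := leb2 R) mH mfn mgn cvfg idom ledom.
  apply: fine_cvg; rewrite fineK; last exact: integrable_fin_num.
  exact: cg.
- near=> eps.
  have [mf [s [B fB]]] : measurable_fun half_plane (fun z : R * R => f eps z.1 z.2) /\
     exists s B : R, forall x t, 0 < t ->
       `|f eps x t| <= B /\ (x <> s * t -> `|f eps x t| <= M) by near: eps.
  apply: (@bounded_locally_integrable2 _ B) => // x t t0; exact: (fB _ _ t0).1.
- exact: (@bounded_locally_integrable2 _ M).
Unshelve. all: end_near.
Qed.

(** * Pressure and characteristic speeds *)

Lemma Rintegral_FTC2 (R : realType) (f F : R -> R) (b : R) : 0 < b ->
  continuous f -> (forall x : R, is_derive x 1 F (f x)) ->
  \int[lebesgue_measure]_(x in `[0, b]) f x = F b - F 0.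
Proof.
move=> b0 cf dF; rewrite /Rintegral (@continuous_FTC2 _ f F)//.
- exact: continuous_subspaceT.
- have cF x : {for x, continuous F}.
    by apply: differentiable_continuous; apply/derivable1_diffP; have [] := dF x.
  split=> [x _||].
  + by have [] := dF x.
  + exact/cvg_at_right_filter/cF.
  + exact/cvg_at_left_filter/cF.
- by move=> x _; rewrite derive1E; have [_ ->] := dF x.
Qed.

Section Pressure.
Variable R : realType.
Implicit Types r eps : R.

Lemma derive1_qflux r : 0 < r -> derive1 (@qflux R) r = r ^+ 2 * expR r.
Proof.
move=> r0; have cq : continuous (fun x : R => x ^+ 2 * expR x).
  by move=> x; apply: cvgM; [exact: exprn_continuous|exact: continuous_expR].
have iq : (@lebesgue_measure R).-integrable `[0, r + 1]
    (EFin \o (fun x : R => x ^+ 2 * expR x)).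
  apply: continuous_compact_integrable; first exact: segment_compact.
  exact: continuous_subspaceT.
have rr1 : r < r + 1 by rewrite ltrDl.
by have [] := continuous_FTC1_closed rr1 iq r0 (cq r).
Qed.

Lemma pressureE r : 0 <= r -> pressure r = (r - 1) * expR r + 1.
Proof.
rewrite le_eqVlt => /predU1P[<-|r0].
  by rewrite /pressure set_itv1 Rintegral_set1 expR0; lra.
rewrite /pressure; under eq_Rintegral => x.
  rewrite inE/= in_itv/= => /andP[x0 _].
  have -> : derive1 (@qflux R) x / x = x * expR x.
    move: x0; rewrite le_eqVlt => /predU1P[<-|x0]; first by rewrite invr0 mulr0 mul0r.
    by rewrite derive1_qflux//; field; exact: lt0r_neq0.
  over.
apply: etrans (Rintegral_FTC2 (F := fun x => (x - 1) * expR x) r0 _ _) _.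
- by move=> x; apply: cvgM; [exact: cvg_id|exact: continuous_expR].
- by move=> x; apply: is_derive_eq; rewrite /GRing.scale/=; ring.
- by rewrite /= expR0; lra.
Qed.

Lemma is_derive_pressure r : 0 < r -> is_derive r 1 (@pressure R) (r * expR r).
Proof.
move=> r0; apply: (near_eq_is_derive (f := fun x : R => (x - 1) * expR x + 1)).
- near=> x; rewrite pressureE// ltW//; near: x; exact: (lt_nbhsr r0).
- by apply: is_derive_eq; rewrite /GRing.scale/=; ring.
Unshelve. all: end_near.
Qed.

Lemma derive1_pressure r : 0 < r -> derive1 (@pressure R) r = r * expR r.
Proof. by move=> r0; rewrite derive1E; have [_ ->] := is_derive_pressure r0. Qed.

Lemma expR_half r : expR r = expR (r / 2) ^+ 2.
Proof. by rewrite expr2 -expRD; congr expR; lra. Qed.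

Lemma sound_speedE eps r : 0 <= eps -> 0 <= r ->
  Num.sqrt (eps * derive1 (@pressure R) r * r) = Num.sqrt eps * r * expR (r / 2).
Proof.
move=> e0; rewrite le_eqVlt => /predU1P[<-|r0].
  by rewrite !mulr0 sqrtr0 mul0r.
rewrite derive1_pressure// -!mulrA sqrtrM// expR_half; congr (_ * _).
have -> : r * (expR (r / 2) ^+ 2 * r) = (r * expR (r / 2)) ^+ 2 by ring.
by rewrite sqrtr_sqr ger0_norm// mulr_ge0 ?expR_ge0// ltW.
Qed.

Lemma curve_slopeE eps r : 0 <= eps -> 0 < r ->
  Num.sqrt (eps * derive1 (@pressure R) r / r) = Num.sqrt eps * expR (r / 2).
Proof.
move=> e0 r0; rewrite derive1_pressure// -!mulrA sqrtrM//; congr (_ * _).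
rewrite mulrCA divff ?mulr1; last exact: lt0r_neq0.
by rewrite expR_half sqrtr_sqr ger0_norm// expR_ge0.
Qed.

Lemma lambda1E eps (U : R * R) : 0 <= eps -> 0 <= U.2 ->
  lambda1 eps U = U.1 - Num.sqrt eps * U.2 * expR (U.2 / 2).
Proof. by move=> e0 r0; rewrite /lambda1 sound_speedE. Qed.

Lemma lambda2E eps (U : R * R) : 0 <= eps -> 0 <= U.2 ->
  lambda2 eps U = U.1 + Num.sqrt eps * U.2 * expR (U.2 / 2).
Proof. by move=> e0 r0; rewrite /lambda2 sound_speedE. Qed.

(** At the density 0 the integrand takes the value 0 instead of sqrt(eps), so
    the left end of the interval has to be removed before the integrand is
    replaced by its closed form. *)
Lemma integral_curve_slope eps r : 0 <= eps -> 0 < r ->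
  \int[lebesgue_measure]_(x in `[0, r])
    Num.sqrt (eps * derive1 (@pressure R) x / x) =
  2 * Num.sqrt eps * (expR (r / 2) - 1).
Proof.
move=> e0 r0; pose h x : R := Num.sqrt eps * expR (x / 2).
have ch : continuous h.
  move=> x; apply: cvgM; first exact: cvg_cst.
  apply: continuous_comp; last exact: continuous_expR.
  by apply: cvgM; [exact: cvg_id|exact: cvg_cst].
have hF : \int[lebesgue_measure]_(x in `[0, r]) h x =
    2 * Num.sqrt eps * (expR (r / 2) - 1).
  apply: etrans (Rintegral_FTC2
    (F := fun x => 2 * Num.sqrt eps * expR (x / 2)) r0 ch _) _.
    by move=> x; apply: is_derive_eq; rewrite /h /GRing.scale/=; field.
  by rewrite /= mul0r expR0; ring.
have ih : (@lebesgue_measure R).-integrable `]0, r] (EFin \o h).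
  have : (@lebesgue_measure R).-integrable `[0, r] (EFin \o h).
    apply: continuous_compact_integrable; first exact: segment_compact.
    exact: continuous_subspaceT.
  apply: integrableS => //=.
  by apply: subset_itvr; rewrite bnd_simp.
have hE : {in `]0, r]%classic,
    h =1 fun x => Num.sqrt (eps * derive1 (@pressure R) x / x)}.
  by move=> x; rewrite inE/= in_itv/= => /andP[x0 _]; rewrite curve_slopeE.
have iS : (@lebesgue_measure R).-integrable `]0, r]
    (EFin \o fun x => Num.sqrt (eps * derive1 (@pressure R) x / x)).
  by apply: eq_integrable ih => // x xr; congr EFin; exact: hE.
rewrite -hF -(Rintegral_itv_obnd_cbnd iS) -(Rintegral_itv_obnd_cbnd ih).
by apply: eq_Rintegral => x xr; rewrite -hE.
Qed.

Lemma vacuum1E eps (U : R * R) : 0 <= eps -> 0 < U.2 ->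
  vacuum1 eps U = U.1 + 2 * Num.sqrt eps * (expR (U.2 / 2) - 1).
Proof. by move=> e0 r0; rewrite /vacuum1 integral_curve_slope. Qed.

Lemma vacuum2E eps (U : R * R) : 0 <= eps -> 0 < U.2 ->
  vacuum2 eps U = U.1 - 2 * Num.sqrt eps * (expR (U.2 / 2) - 1).
Proof. by move=> e0 r0; rewrite /vacuum2 integral_curve_slope. Qed.
End Pressure.

(** * Rarefaction fans *)

Section SimpleWave.
Variable R : realType.
Implicit Types r s y : R.

(** Up to scaling and translation, the characteristic speed along a
    rarefaction curve, as a function of the density. *)
Definition wave_speed r : R := (2 + r) * expR (r / 2).

(** The inverse of [wave_speed] is taken on densities r >= -1, where
    [wave_speed] still increases: its value 2 at the vacuum r = 0 is then an
    interior point, and the inverse is differentiable up to the vacuum. *)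
Definition wave_density y : R :=
  get [set r : R | -1 <= r /\ wave_speed r = y].

Lemma wave_speed_lt r s : -1 <= r -> r < s -> wave_speed r < wave_speed s.
Proof.
move=> r1 rs; apply: ltr_pM; rewrite ?expR_ge0 ?ltr_expR; lra.
Qed.

Lemma wave_speed_continuous : continuous wave_speed.
Proof.
move=> r; apply: differentiable_continuous; apply/derivable1_diffP.
by apply: ex_derive.
Qed.

Lemma wave_densityP y : 1 <= y ->
  -1 <= wave_density y /\ wave_speed (wave_density y) = y.
Proof.
move=> y1.
have [r] : exists2 r, r \in `[-1, y] & wave_speed r = y.
  apply: IVT; first lra.
    by apply: continuous_subspaceT; exact: wave_speed_continuous.
  apply/andP; split.
    rewrite ge_min; apply/orP; left; rewrite /wave_speed.
    have : expR (-1 / 2) <= 1 :> R by rewrite -[leRHS]expR0 ler_expR; lra.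
    lra.
  rewrite le_max; apply/orP; right; rewrite /wave_speed.
  have : 1 <= expR (y / 2) :> R by rewrite -[leLHS]expR0 ler_expR; lra.
  nra.
rewrite in_itv/= => /andP[r1 _] ry.
exact: (@getPex _ [set r : R | -1 <= r /\ wave_speed r = y]
  (ex_intro _ r (conj r1 ry))).
Qed.

Lemma wave_densityK r : -1 <= r -> wave_density (wave_speed r) = r.
Proof.
move=> r1.
have [h1 e] := @getPex _ [set q : R | -1 <= q /\ wave_speed q = wave_speed r]
  (ex_intro _ r (conj r1 erefl)).
have [/(wave_speed_lt h1)|/(wave_speed_lt r1)|//] := ltgtP (wave_density (wave_speed r)) r.
  by rewrite e ltxx.
by rewrite e ltxx.
Qed.

Lemma wave_speed0 : wave_speed 0 = 2 :> R.
Proof. by rewrite /wave_speed mul0r expR0; lra. Qed.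

Lemma wave_density_lt y z : 1 <= y -> y < z -> wave_density y < wave_density z.
Proof.
move=> y1 yz; have [hy ey] := wave_densityP y1.
have [hz ez] : -1 <= wave_density z /\ wave_speed (wave_density z) = z.
  by apply: wave_densityP; lra.
rewrite ltNge le_eqVlt; apply/negP => /predU1P[e|/(wave_speed_lt hz)]; last lra.
by move: yz; rewrite -ey -ez e ltxx.
Qed.

Lemma wave_density_ge0 y : 2 <= y -> 0 <= wave_density y.
Proof.
rewrite le_eqVlt => /predU1P[<-|y2].
  by rewrite -wave_speed0 wave_densityK//; lra.
rewrite ltW// -[ltLHS]wave_densityK; last lra.
by rewrite wave_speed0 wave_density_lt//; lra.
Qed.

Lemma is_derive_wave_density y : 2 <= y ->
  let r := wave_density y in
  is_derive y 1 wave_density ((2 + r / 2) * expR (r / 2))^-1.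
Proof.
move=> y2 r; have r0 : 0 <= r := wave_density_ge0 y2.
have [_ ry] : -1 <= r /\ wave_speed r = y by apply: wave_densityP; lra.
rewrite -[X in is_derive X]ry; apply: is_derive_inverse.
- have r1 : -1 < r by lra.
  by apply: filterS (lt_nbhsr r1) => q /ltW/wave_densityK.
- by near=> q; exact: wave_speed_continuous.
- by rewrite /wave_speed; apply: is_derive_eq; rewrite /GRing.scale/=; field.
- by rewrite lt0r_neq0// mulr_gt0 ?expR_gt0//; lra.
Unshelve. all: end_near.
Qed.

End SimpleWave.

Section Fan.
Variables (R : realType) (eps : R).
Hypothesis eps0 : 0 < eps.

(** The chain rule turns the system into two ordinary differential equations
    for the profile, with coefficients u - x/t. *)
Lemma self_similar_solves (W : R -> R * R) (x t u' r' : R) :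
  let xi := x / t in
  0 < t -> 0 < (W xi).2 ->
  is_derive xi 1 (fun y => (W y).1) u' -> is_derive xi 1 (fun y => (W y).2) r' ->
  ((W xi).1 - xi) * u' + eps * ((W xi).2 * expR (W xi).2 * r') = 0 ->
  ((W xi).1 - xi) * r' + (W xi).2 * u' = 0 ->
  solves_system_at eps (fun y s => (W (y / s)).1) (fun y s => (W (y / s)).2) x t.
Proof.
move=> xi t0 W0 du dr equ eqr.
have t_neq0 := lt0r_neq0 t0.
have dx : is_derive x 1 (fun y => y / t) t^-1.
  by apply: is_derive_eq; rewrite /GRing.scale/=; ring.
have dt : is_derive t 1 (fun s => x / s) (- xi / t).
  have dV := is_deriveV t_neq0 (is_derive_id t (1 : R)).
  by apply: is_derive_eq; rewrite /GRing.scale/= /xi; field.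
have dxu : is_derive x 1 (fun y => (W (y / t)).1) (u' / t).
  exact: (is_derive1_comp (g := fun y => y / t) du dx).
have dxr : is_derive x 1 (fun y => (W (y / t)).2) (r' / t).
  exact: (is_derive1_comp (g := fun y => y / t) dr dx).
have dtu : is_derive t 1 (fun s => (W (x / s)).1) (u' * (- xi / t)).
  exact: (is_derive1_comp (g := fun s => x / s) du dt).
have dtr : is_derive t 1 (fun s => (W (x / s)).2) (r' * (- xi / t)).
  exact: (is_derive1_comp (g := fun s => x / s) dr dt).
have dp : is_derive x 1 (fun y => pressure (W (y / t)).2)
    (((W xi).2 * expR (W xi).2) * (r' / t)).
  apply: (is_derive1_comp (f := @pressure R) (g := fun y => (W (y / t)).2)) => //.
  exact: is_derive_pressure.
have dflux : is_derive x 1 (fun y => flux eps (W (y / t)).1 (W (y / t)).2)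
   ((W xi).1 * (u' / t) + eps * (((W xi).2 * expR (W xi).2) * (r' / t))).
  by rewrite /flux; apply: is_derive_eq; rewrite /GRing.scale/= -/xi; field.
have dm : is_derive x 1 (fun y => (W (y / t)).2 * (W (y / t)).1)
   ((W xi).2 * (u' / t) + (W xi).1 * (r' / t)).
  by apply: is_derive_eq; rewrite /GRing.scale/=.
split.
- by split; [case: dtu|case: dxu].
- by split; [case: dtr|case: dxr].
- rewrite !derive1E; case: dtu => _ ->; case: dflux => _ ->.
  have -> : u' * (- xi / t) + ((W xi).1 * (u' / t) +
    eps * (((W xi).2 * expR (W xi).2) * (r' / t))) =
   (((W xi).1 - xi) * u' + eps * ((W xi).2 * expR (W xi).2 * r')) / t by ring.
  by rewrite equ mul0r.
- rewrite !derive1E; case: dtr => _ ->; case: dm => _ ->.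
  have -> : r' * (- xi / t) + ((W xi).2 * (u' / t) + (W xi).1 * (r' / t)) =
   (((W xi).1 - xi) * r' + (W xi).2 * u') / t by ring.
  by rewrite eqr mul0r.
Qed.

Variables (sg u0 : R).
Hypothesis sg2 : sg ^+ 2 = 1.

Let d := Num.sqrt eps.

Let d0 : 0 < d. Proof. by rewrite sqrtr_gt0. Qed.

Let dd : eps = d ^+ 2. Proof. by rewrite sqr_sqrtr// ltW. Qed.

(** The solutions of du/dr = sg sqrt(eps) e^(r/2); the constant u0 is the
    value of a Riemann invariant. *)
Definition wave_velocity r : R := u0 + 2 * sg * d * expR (r / 2).

Definition simple_wave (xi : R) : R * R :=
  let r := wave_density (sg * (xi - u0) / d) in (wave_velocity r, r).

(** The conclusions say that the profile is characteristic, with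
    lambda = x/t, and that du/dr is the slope of the rarefaction curve; these
    are the two facts that make it a solution of the system. *)
Lemma simple_waveP xi : 2 <= sg * (xi - u0) / d ->
  let W := simple_wave xi in
  [/\ 0 <= W.2, W.1 + sg * d * W.2 * expR (W.2 / 2) = xi,
      {for xi, continuous simple_wave} &
      exists2 r', is_derive xi 1 (fun y => (simple_wave y).2) r' &
        is_derive xi 1 (fun y => (simple_wave y).1)
          (sg * d * expR (W.2 / 2) * r')].
Proof.
move=> y2; rewrite /simple_wave/=; set y := sg * (xi - u0) / d in y2 *.
set r := wave_density y.
have [_ ry] : -1 <= r /\ wave_speed r = y by apply: wave_densityP; lra.
have d_neq0 := lt0r_neq0 d0.
have Hr := is_derive_wave_density y2.
have dy : is_derive xi 1 (fun x => sg * (x - u0) / d) (sg / d).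
  by apply: is_derive_eq; rewrite /GRing.scale/=; ring.
have [r' dr] : exists r', is_derive xi 1
    (fun x => wave_density (sg * (x - u0) / d)) r'.
  eexists; exact: (is_derive1_comp (g := fun x => sg * (x - u0) / d) Hr dy).
have du : is_derive xi 1
    (fun x => wave_velocity (wave_density (sg * (x - u0) / d)))
    (sg * d * expR (r / 2) * r').
  have dv : is_derive r 1 wave_velocity (sg * d * expR (r / 2)).
    by rewrite /wave_velocity; apply: is_derive_eq; rewrite /GRing.scale/=; field.
  exact: (is_derive1_comp (g := fun x => wave_density (sg * (x - u0) / d)) dv dr).
split.
- exact: wave_density_ge0.
- have : sg * d * wave_speed r = xi - u0.
    by rewrite ry /y -[RHS]mul1r -sg2; field.
  by rewrite /wave_velocity /wave_speed => e; lra.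
- have cont (f : R -> R) df : is_derive xi 1 f df -> f x @[x --> xi] --> f xi.
    by case=> ? _; apply: differentiable_continuous; exact/derivable1_diffP.
  exact: (cvg_pair (cont _ _ du) (cont _ _ dr)).
- by exists r'.
Qed.

Lemma simple_waveK r : 0 <= r ->
  simple_wave (u0 + sg * d * wave_speed r) = (wave_velocity r, r).
Proof.
move=> r0; rewrite /simple_wave.
have -> : sg * (u0 + sg * d * wave_speed r - u0) / d = wave_speed r.
  by rewrite -[RHS]mul1r -sg2; field; exact: lt0r_neq0.
by rewrite wave_densityK//; lra.
Qed.

(** Both families of rarefactions, and fans with a vacuum end state, are the
    same simple wave up to the sign sg.  Only the values of W between the two
    characteristic speeds are prescribed, so that W can be extended by any
    other waves. *)
Lemma simple_wave_fan (lambda : R * R -> R) (slope : R -> R) (r1 r2 : R)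
    (W : R -> R * R) :
  let U := (wave_velocity r1, r1) in let V := (wave_velocity r2, r2) in
  (forall X, 0 <= X.2 -> lambda X = X.1 + sg * d * X.2 * expR (X.2 / 2)) ->
  (forall r, 0 < r -> slope r = sg * d * expR (r / 2)) ->
  0 <= r1 -> 0 <= r2 -> 0 < sg * (r2 - r1) ->
  (forall xi, lambda U <= xi <= lambda V -> W xi = simple_wave xi) ->
  fan eps lambda slope U V W /\
  forall xi eta, lambda U <= xi -> xi < eta -> eta <= lambda V ->
    0 < sg * ((W eta).2 - (W xi).2).
Proof.
move=> U V lamE slopeE r1_ge0 r2_ge0 r12.
have lamU : lambda U = u0 + sg * d * wave_speed r1.
  by rewrite /U lamE//= /wave_velocity /wave_speed -/d; ring.
have lamV : lambda V = u0 + sg * d * wave_speed r2.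
  by rewrite /V lamE//= /wave_velocity /wave_speed -/d; ring.
rewrite lamU lamV => WE.
have sgP : sg = 1 \/ sg = -1.
  move/eqP: sg2; rewrite -subr_eq0 subr_sqr_1 mulf_eq0 subr_eq0 addr_eq0.
  by move=> /orP[]/eqP; [left|right].
have hs (r s : R) : 0 <= r -> r < s -> wave_speed r < wave_speed s.
  by move=> ? ?; apply: wave_speed_lt => //; lra.
have h2 (r : R) : 0 <= r -> 2 <= wave_speed r.
  rewrite le_eqVlt => /predU1P[<-|/(hs _ _ (lexx _))/ltW].
    by rewrite wave_speed0.
  by rewrite wave_speed0.
have lt12 : u0 + sg * d * wave_speed r1 < u0 + sg * d * wave_speed r2.
  rewrite ltrD2l; move: r12 d0; case: sgP => -> r12 d0'.
    by rewrite !mul1r ltr_pM2l// hs//; lra.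
  by rewrite !mulN1r !mulNr ltrN2 ltr_pM2l// hs//; lra.
(* On the fan the rescaled similarity variable stays in the range [2, +oo[ of
   [wave_speed] over nonnegative densities. *)
have yP xi : u0 + sg * d * wave_speed r1 <= xi <= u0 + sg * d * wave_speed r2 ->
    2 <= sg * (xi - u0) / d.
  move=> /andP[x1 x2]; rewrite ler_pdivlMr//.
  have := h2 _ r1_ge0; have := h2 _ r2_ge0; move: x1 x2; have := d0.
  by case: sgP => ->; nra.
have ylt xi : u0 + sg * d * wave_speed r1 < xi < u0 + sg * d * wave_speed r2 ->
    2 < sg * (xi - u0) / d.
  move=> /andP[x1 x2]; rewrite ltr_pdivlMr//.
  have := h2 _ r1_ge0; have := h2 _ r2_ge0; move: x1 x2; have := d0.
  by case: sgP => ->; nra.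
split; last first.
  move=> xi eta x1 xe e2.
  have y1 : 2 <= sg * (xi - u0) / d by apply: yP; lra.
  have y2 : 2 <= sg * (eta - u0) / d by apply: yP; lra.
  rewrite !WE; [|lra|lra].
  rewrite /simple_wave/=; move: y1 y2; case: sgP => ->; rewrite ?mulN1r ?mul1r => y1 y2.
    rewrite subr_gt0; apply: wave_density_lt; first lra.
    by rewrite ltr_pM2r ?invr_gt0//; lra.
  rewrite oppr_gt0 subr_lt0; apply: wave_density_lt; first lra.
  by rewrite ltr_pM2r ?invr_gt0//; lra.
rewrite /fan lamU lamV; split.
- split=> //.
  apply: (@subspace_eq_continuous _ _ _ simple_wave).
    by move=> xi; rewrite inE/= in_itv/= => /WE/esym.
  apply: continuous_in_subspaceT => xi; rewrite inE/= in_itv/= => /yP y2.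
  by have [] := simple_waveP y2.
- by split; rewrite WE ?simple_waveK// lexx ltW.
- move=> xi xab; have := yP _ xab => /simple_waveP[W0 WL _ _].
  by rewrite WE// lamE.
- move=> x t t0 xab.
  have y2 := ylt _ xab; have [W0 WL _ [r' dr du]] := simple_waveP (ltW y2).
  have W2 : W (x / t) = simple_wave (x / t).
    by apply: WE; case/andP: xab => /ltW-> /ltW->.
  have Wnear : \forall y \near x / t, simple_wave y = W y.
    case/andP: xab => x1 x2.
    near=> y; apply/esym/WE; apply/andP; split; apply: ltW; near: y.
      exact: lt_nbhsr.
    exact: lt_nbhsl.
  have rpos : 0 < (simple_wave (x / t)).2.
    rewrite /simple_wave/=.
    have := @wave_density_lt _ 2 _ _ y2; rewrite -{2}(@wave_speed0 R) wave_densityK; last lra.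
    by apply; lra.
  apply: (self_similar_solves t0 (r' := r')
    (u' := sg * d * expR ((simple_wave (x / t)).2 / 2) * r')).
  + by rewrite W2.
  + apply: near_eq_is_derive du; near=> y; congr fst; near: y; exact: Wnear.
  + apply: near_eq_is_derive dr; near=> y; congr snd; near: y; exact: Wnear.
  + rewrite W2; move: WL; set w := simple_wave _ => <-.
    rewrite (expR_half w.2) dd; move: (expR (w.2 / 2)) => E.
    transitivity ((1 - sg ^+ 2) * (d ^+ 2 * w.2 * E ^+ 2 * r')); first ring.
    by rewrite sg2 subrr mul0r.
  + by rewrite W2; move: WL; set w := simple_wave _ => <-; ring.
- exists wave_velocity; split.
  + apply: continuous_subspaceT => r; apply: differentiable_continuous.
    by apply/derivable1_diffP; rewrite /wave_velocity; apply: ex_derive.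
  + move=> r r0; rewrite slopeE//; rewrite /wave_velocity.
    by apply: is_derive_eq; rewrite /GRing.scale/=; field.
  + by move=> xi xab; rewrite WE.
Unshelve. all: end_near.
Qed.

End Fan.

(** * Shocks and the intermediate state *)

Section Shock.
Variable R : realType.
Implicit Types r m c u eps sg : R.

(** This is Cauchy's mean value theorem for the pressure and the square
    function, whose derivatives have the ratio e^c / 2 at c. *)
Lemma pressure_mean r m : 0 < r -> r < m ->
  exists2 c, r < c < m &
    pressure m - pressure r = expR c / 2 * (m ^+ 2 - r ^+ 2).
Proof.
move=> r0 rm.
have dp x : x \in `]r, m[ -> is_derive x 1 (@pressure R) (x * expR x).
  by rewrite in_itv/= => /andP[rx _]; apply: is_derive_pressure; lra.
have ds x : x \in `]r, m[ -> is_derive x 1 (fun y : R => y ^+ 2) (2 * x).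
  by move=> _; apply: is_derive_eq; rewrite /GRing.scale/=; ring.
have cp : {within `[r, m], continuous (@pressure R)}.
  apply: derivable_within_continuous => x; rewrite in_itv/= => /andP[rx _].
  by have [] := @is_derive_pressure _ x; first lra.
have cs : {within `[r, m], continuous (fun y : R => y ^+ 2)}.
  by apply: continuous_subspaceT; exact: exprn_continuous.
have ds0 x : x \in `]r, m[ -> 2 * x != 0.
  by rewrite in_itv/= => /andP[rx _]; rewrite lt0r_neq0//; lra.
have [c cm e] := cauchy_MVT rm cp cs dp ds ds0.
exists c; first by move: cm; rewrite in_itv.
have c0 : c != 0 by move: cm; rewrite in_itv/= => /andP[rc _]; rewrite lt0r_neq0//; lra.
have d0 : m ^+ 2 - r ^+ 2 != 0 by rewrite lt0r_neq0//; nra.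
have {}e : pressure m - pressure r = c * expR c / (2 * c) * (m ^+ 2 - r ^+ 2).
  by rewrite e divfK.
by rewrite e; field.
Qed.

(** The shock joins the densities r and m, the rarefaction joins m and s; r and
    s are the initial densities.  The last equation says that the two velocity
    changes cancel, as they must when the initial velocities agree.  It is
    solved in the squared form
    (m + r) (2 (e^(s/2) - e^(m/2)))^2 = 2 (p(m) - p(r)) (m - r),
    whose two sides compare in opposite ways at m = r and at m = s. *)
Lemma middle_density (r s : R) : 0 < r -> r < s ->
  exists m c, [/\ r < m < s, r < c < m,
    pressure m - pressure r = expR c / 2 * (m ^+ 2 - r ^+ 2) &
    2 * (expR (s / 2) - expR (m / 2)) = expR (c / 2) * (m - r)].
Proof.
move=> r0 rs.
pose p x : R := (x - 1) * expR x.
pose F m : R := (m + r) * (2 * (expR (s / 2) - expR (m / 2))) ^+ 2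
  - 2 * (p m - p r) * (m - r).
have cF : continuous F.
  move=> x; apply: differentiable_continuous; apply/derivable1_diffP.
  by rewrite /F /p; apply: ex_derive.
have Es : expR (r / 2) < expR (s / 2) by rewrite ltr_expR; lra.
have Fr : 0 < F r.
  by rewrite /F !subrr mulr0 subr0 mulr_gt0 ?exprn_gt0//; lra.
have pE x : 0 <= x -> p x = pressure x - 1.
  by move=> x0; rewrite pressureE// /p; ring.
have Fs : F s < 0.
  rewrite /F !subrr !mulr0 expr0n/= mulr0 sub0r oppr_lt0.
  rewrite !pE; [|lra|lra].
  have [c _] := pressure_mean r0 rs.
  have -> : pressure s - 1 - (pressure r - 1) = pressure s - pressure r by ring.
  move=> ->; have := expR_gt0 c => Ec.
  by rewrite !mulr_gt0//; nra.
have [m] : exists2 m, m \in `[r, s] & F m = 0.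
  apply: IVT; [exact: ltW|exact: continuous_subspaceT|].
  by rewrite ge_min le_max (ltW Fr) (ltW Fs) orbT.
rewrite in_itv/= => /andP[rm ms] Fm.
have {}rm : r < m.
  by rewrite lt_neqAle rm andbT; apply: contraTN Fr => /eqP->; rewrite Fm ltxx.
have {}ms : m < s.
  by rewrite lt_neqAle ms andbT; apply: contraTN Fs => /eqP<-; rewrite Fm ltxx.
have [c rcm Pm] := pressure_mean r0 rm.
exists m, c; split=> //; first exact/andP.
have Em : expR (m / 2) < expR (s / 2) by rewrite ltr_expR; lra.
have Ec := expR_gt0 (c / 2).
apply/eqP; rewrite -(@eqrXn2 _ 2)//; [|lra|by rewrite mulr_ge0//; lra].
have mr0 : m + r != 0 by rewrite lt0r_neq0//; lra.
apply/eqP/(mulfI mr0).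
have {}Pm : p m - p r = expR c / 2 * (m ^+ 2 - r ^+ 2).
  by rewrite -Pm !pE; [ring|lra|lra].
move/eqP: Fm; rewrite /F subr_eq0 Pm (expR_half c) => /eqP ->.
by field.
Qed.

(** The relations do not change when the two states are exchanged; it is the
    sign sg that decides which order satisfies the Lax inequalities. *)
Lemma shock_rankine_hugoniot eps sg u r m c : 0 <= eps -> sg ^+ 2 = 1 ->
  pressure m - pressure r = expR c / 2 * (m ^+ 2 - r ^+ 2) ->
  let g := sg * Num.sqrt eps * expR (c / 2) in
  rankine_hugoniot eps (u + g * (m - r), m) (u, r) (u + g * m) /\
  rankine_hugoniot eps (u, r) (u + g * (m - r), m) (u + g * m).
Proof.
move=> e0 sg2 pmr g.
have gg : g ^+ 2 = eps * expR c.
  by rewrite /g !exprMn sg2 mul1r sqr_sqrtr// -expR_half.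
have ep : eps * pressure m = eps * pressure r + g ^+ 2 / 2 * (m ^+ 2 - r ^+ 2).
  have -> : pressure m = pressure r + expR c / 2 * (m ^+ 2 - r ^+ 2) by lra.
  by rewrite gg; field.
by rewrite /rankine_hugoniot /flux/= ep; split; split; field.
Qed.

(** The shock moves at sqrt(eps) m e^(c/2) relative to the velocity on its
    right, and at sqrt(eps) r e^(c/2) relative to the velocity on its left.  The
    Lax inequalities thus compare
    r e^(r/2) with m e^(c/2), and r e^(c/2) with m e^(m/2). *)
Lemma middle_shock2 eps u r m c : 0 < eps -> 0 < r -> r < c < m ->
  pressure m - pressure r = expR c / 2 * (m ^+ 2 - r ^+ 2) ->
  let g := Num.sqrt eps * expR (c / 2) in
  shock2 eps (u + g * (m - r), m) (u, r) (u + g * m).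
Proof.
move=> e0 r0 /andP[rc cm] pmr g; have d0 : 0 < Num.sqrt eps by rewrite sqrtr_gt0.
have [] := shock_rankine_hugoniot (sg := 1) u (ltW e0) (expr1n _ _) pmr.
rewrite mul1r -/g => rh _.
have E1 : expR (r / 2) < expR (c / 2) by rewrite ltr_expR; lra.
have E2 : expR (c / 2) < expR (m / 2) by rewrite ltr_expR; lra.
have E0 := expR_gt0 (r / 2).
split=> //.
- by case=> _ mr; lra.
- rewrite lambda2E ?(ltW e0) ?(ltW r0)//= ltrD2l /g -!mulrA ltr_pM2l//.
  by rewrite (mulrC r) ltr_pM//; lra.
- rewrite lambda1E ?lambda2E//=; [|lra|lra|lra|lra].
  have : g * r < Num.sqrt eps * m * expR (m / 2).
    by rewrite /g -!mulrA ltr_pM2l// (mulrC m) ltr_pM//; lra.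
  have : 0 < g * r by rewrite !mulr_gt0//; lra.
  have : 0 < Num.sqrt eps * m * expR (m / 2) by rewrite !mulr_gt0//; lra.
  by move=> *; lra.
Qed.

(** This is the mirror image of a 2-shock under (x, u) -> (-x, -u). *)
Lemma middle_shock1 eps u r m c : 0 < eps -> 0 < r -> r < c < m ->
  pressure m - pressure r = expR c / 2 * (m ^+ 2 - r ^+ 2) ->
  let g := Num.sqrt eps * expR (c / 2) in
  shock1 eps (u, r) (u - g * (m - r), m) (u - g * m).
Proof.
move=> e0 r0 /andP[rc cm] pmr g; have d0 : 0 < Num.sqrt eps by rewrite sqrtr_gt0.
have [] := shock_rankine_hugoniot (sg := -1) u (ltW e0) (etrans (sqrrN 1) (expr1n _ _)) pmr.
rewrite mulN1r !mulNr -/g => _ rh.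
have E1 : expR (r / 2) < expR (c / 2) by rewrite ltr_expR; lra.
have E2 : expR (c / 2) < expR (m / 2) by rewrite ltr_expR; lra.
have E0 := expR_gt0 (r / 2).
split=> //.
- by case=> _ mr; lra.
- rewrite lambda1E ?(ltW e0) ?(ltW r0)//= ltrD2l ltrN2 /g -!mulrA ltr_pM2l//.
  by rewrite (mulrC r) ltr_pM//; lra.
- rewrite lambda1E ?lambda2E//=; [|lra|lra|lra|lra].
  have : g * r < Num.sqrt eps * m * expR (m / 2).
    by rewrite /g -!mulrA ltr_pM2l// (mulrC m) ltr_pM//; lra.
  have : 0 < g * r by rewrite !mulr_gt0//; lra.
  have : 0 < Num.sqrt eps * m * expR (m / 2) by rewrite !mulr_gt0//; lra.
  by move=> *; lra.
Qed.

End Shock.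

(** * Riemann solutions *)

(** Evaluates a piecewise profile: every outcome of the tests that contradicts
    the order of the speeds is discarded by linear arithmetic. *)
Ltac split_ifs :=
  repeat (first [case: ltP => ? | case: leP => ?]); try reflexivity;
  exfalso; lra.

Section Existence.
Variables (R : realType) (eps : R).
Hypothesis eps0 : 0 < eps.

Let lam1 (X : R * R) : 0 <= X.2 ->
  lambda1 eps X = X.1 + -1 * Num.sqrt eps * X.2 * expR (X.2 / 2).
Proof. by move=> X2; rewrite lambda1E ?(ltW eps0)// mulN1r !mulNr. Qed.

Let lam2 (X : R * R) : 0 <= X.2 ->
  lambda2 eps X = X.1 + 1 * Num.sqrt eps * X.2 * expR (X.2 / 2).
Proof. by move=> X2; rewrite lambda2E ?(ltW eps0)// mul1r. Qed.

Lemma simple_wave_rarefaction1 (u0 r1 r2 : R) (W : R -> R * R) :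
  0 <= r2 -> r2 < r1 ->
  let U := (wave_velocity eps (-1) u0 r1, r1) in
  let V := (wave_velocity eps (-1) u0 r2, r2) in
  (forall xi, lambda1 eps U <= xi <= lambda1 eps V ->
     W xi = simple_wave eps (-1) u0 xi) ->
  rarefaction1 eps U V W.
Proof.
move=> r20 r21 U V WE.
have [] := simple_wave_fan eps0 (etrans (sqrrN 1) (expr1n _ _)) (lambda := lambda1 eps)
  (slope := fun r => - Num.sqrt (eps * derive1 (@pressure R) r / r))
  (r1 := r1) (r2 := r2) lam1 _ _ r20 _ WE; [|lra|lra|].
  by move=> r r0; rewrite curve_slopeE ?ltW//; ring.
by move=> fanW mono; split=> // xi eta x1 xe e2; have := mono _ _ x1 xe e2; lra.
Qed.

Lemma simple_wave_rarefaction2 (u0 r1 r2 : R) (W : R -> R * R) :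
  0 <= r1 -> r1 < r2 ->
  let U := (wave_velocity eps 1 u0 r1, r1) in
  let V := (wave_velocity eps 1 u0 r2, r2) in
  (forall xi, lambda2 eps U <= xi <= lambda2 eps V ->
     W xi = simple_wave eps 1 u0 xi) ->
  rarefaction2 eps U V W.
Proof.
move=> r20 r21 U V WE.
have [] := simple_wave_fan eps0 (expr1n _ _) (lambda := lambda2 eps)
  (slope := fun r => Num.sqrt (eps * derive1 (@pressure R) r / r))
  (r1 := r1) (r2 := r2) lam2 _ r20 _ _ WE; [|lra|lra|].
  by move=> r r0; rewrite curve_slopeE ?ltW//; ring.
by move=> fanW mono; split=> // xi eta x1 xe e2; have := mono _ _ x1 xe e2; lra.
Qed.

Lemma rarefaction1_lt (U V : R * R) W : rarefaction1 eps U V W ->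
  lambda1 eps U < lambda1 eps V.
Proof. by case=> -[[]]. Qed.

Lemma rarefaction2_lt (U V : R * R) W : rarefaction2 eps U V W ->
  lambda2 eps U < lambda2 eps V.
Proof. by case=> -[[]]. Qed.

Lemma rarefaction_shock_exists (u rl rr : R) : 0 < rr -> rr < rl ->
  exists W, riemann_profile eps (u, rl) (u, rr) W.
Proof.
move=> rr0 rlr; have [m [c [/andP[rm ml] /andP[rc cm] Pm Em]]] := middle_density rr0 rlr.
pose u0 := u + 2 * Num.sqrt eps * expR (rl / 2).
pose g := Num.sqrt eps * expR (c / 2).
have Ul : (u, rl) = (wave_velocity eps (-1) u0 rl, rl).
  by rewrite /wave_velocity /u0; congr pair; ring.
have Um : (u + g * (m - rr), m) = (wave_velocity eps (-1) u0 m, m).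
  by rewrite /wave_velocity /u0 /g -mulrA -Em; congr pair; ring.
have sh : shock2 eps (u + g * (m - rr), m) (u, rr) (u + g * m).
  by apply: middle_shock2 => //; apply/andP.
set M := (u + g * (m - rr), m) in Um sh *; set s := u + g * m in sh.
have ab : lambda1 eps (u, rl) < lambda1 eps M.
  rewrite Ul Um; apply: (rarefaction1_lt (W := simple_wave eps (-1) u0)).
  by apply: simple_wave_rarefaction1 => //; lra.
have bs : lambda1 eps M < s by case: sh => _ _ _ /andP[].
exists (fun xi => if xi < lambda1 eps (u, rl) then (u, rl) else
  if xi <= lambda1 eps M then simple_wave eps (-1) u0 xi else
  if xi <= s then M else (u, rr)).
apply: (@riemann_rarefaction_shock _ _ _ _ _ M s) => //=.
- lra.
- rewrite Ul Um; apply: simple_wave_rarefaction1; [lra|lra|] => xi.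
  by rewrite -Ul -Um => /andP[x1 x2]; clear -ab bs x1 x2; split_ifs.
- by move=> xi ->.
- by move=> xi /andP[x1 x2]; clear -ab bs x1 x2; split_ifs.
- by move=> xi x1; clear -ab bs x1; split_ifs.
Qed.

Lemma shock_rarefaction_exists (u rl rr : R) : 0 < rl -> rl < rr ->
  exists W, riemann_profile eps (u, rl) (u, rr) W.
Proof.
move=> rl0 rlr; have [m [c [/andP[rm ml] /andP[rc cm] Pm Em]]] := middle_density rl0 rlr.
pose u0 := u - 2 * Num.sqrt eps * expR (rr / 2).
pose g := Num.sqrt eps * expR (c / 2).
have Ur : (u, rr) = (wave_velocity eps 1 u0 rr, rr).
  by rewrite /wave_velocity /u0; congr pair; ring.
have Um : (u - g * (m - rl), m) = (wave_velocity eps 1 u0 m, m).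
  by rewrite /wave_velocity /u0 /g -mulrA -Em; congr pair; ring.
have sh : shock1 eps (u, rl) (u - g * (m - rl), m) (u - g * m).
  by apply: middle_shock1 => //; apply/andP.
set M := (u - g * (m - rl), m) in Um sh *; set s := u - g * m in sh.
have ab : lambda2 eps M < lambda2 eps (u, rr).
  rewrite Ur Um; apply: (rarefaction2_lt (W := simple_wave eps 1 u0)).
  by apply: simple_wave_rarefaction2 => //; lra.
have bs : s < lambda2 eps M by case: sh => _ _ _ /andP[].
exists (fun xi => if xi < s then (u, rl) else
  if xi < lambda2 eps M then M else
  if xi <= lambda2 eps (u, rr) then simple_wave eps 1 u0 xi else (u, rr)).
apply: (@riemann_shock_rarefaction _ _ _ _ _ M s) => //=.
- lra.
- rewrite Ur Um; apply: simple_wave_rarefaction2; [lra|lra|] => xi.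
  by rewrite -Ur -Um => /andP[x1 x2]; clear -ab bs x1 x2; split_ifs.
- by move=> xi ->.
- by move=> xi /andP[x1 x2]; clear -ab bs x1 x2; split_ifs.
- by move=> xi x1; clear -ab bs x1; split_ifs.
Qed.

Lemma vacuum_exists (ul ur rl rr : R) : 0 < rl -> 0 < rr -> ul < ur ->
  vacuum1 eps (ul, rl) < vacuum2 eps (ur, rr) ->
  exists W, riemann_profile eps (ul, rl) (ur, rr) W.
Proof.
move=> rl0 rr0 ulr v12.
pose u1 := ul + 2 * Num.sqrt eps * expR (rl / 2).
pose u2 := ur - 2 * Num.sqrt eps * expR (rr / 2).
have Ul : (ul, rl) = (wave_velocity eps (-1) u1 rl, rl).
  by rewrite /wave_velocity /u1; congr pair; ring.
have Ur : (ur, rr) = (wave_velocity eps 1 u2 rr, rr).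
  by rewrite /wave_velocity /u2; congr pair; ring.
have V1 : (vacuum1 eps (ul, rl), 0) = (wave_velocity eps (-1) u1 0, 0) :> R * R.
  by rewrite vacuum1E ?(ltW eps0)//= /wave_velocity /u1 mul0r expR0; congr pair; ring.
have V2 : (vacuum2 eps (ur, rr), 0) = (wave_velocity eps 1 u2 0, 0) :> R * R.
  by rewrite vacuum2E ?(ltW eps0)//= /wave_velocity /u2 mul0r expR0; congr pair; ring.
set v1 := vacuum1 _ _ in V1 v12; set v2 := vacuum2 _ _ in V2 v12.
have l1 : lambda1 eps (v1, 0) = v1.
  by rewrite lambda1E ?(ltW eps0)//= mulr0 mul0r subr0.
have l2 : lambda2 eps (v2, 0) = v2.
  by rewrite lambda2E ?(ltW eps0)//= mulr0 mul0r addr0.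
have ab1 : lambda1 eps (ul, rl) < v1.
  rewrite -l1 V1 Ul; apply: (rarefaction1_lt (W := simple_wave eps (-1) u1)).
  exact: simple_wave_rarefaction1.
have ab2 : v2 < lambda2 eps (ur, rr).
  rewrite -l2 V2 Ur; apply: (rarefaction2_lt (W := simple_wave eps 1 u2)).
  exact: simple_wave_rarefaction2.
exists (fun xi => if xi < lambda1 eps (ul, rl) then (ul, rl) else
  if xi <= v1 then simple_wave eps (-1) u1 xi else
  if xi < v2 then (xi, 0) else
  if xi <= lambda2 eps (ur, rr) then simple_wave eps 1 u2 xi else (ur, rr)).
apply: riemann_vacuum => //=; rewrite -/v1 -/v2.
- rewrite V1 Ul; apply: simple_wave_rarefaction1 => // xi.
  by rewrite -Ul -V1 l1 => /andP[x1 x2]; clear -v12 ab1 ab2 x1 x2; split_ifs.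
- rewrite V2 Ur; apply: simple_wave_rarefaction2 => // xi.
  by rewrite -Ur -V2 l2 => /andP[x1 x2]; clear -v12 ab1 ab2 x1 x2; split_ifs.
- by move=> xi ->.
- by move=> xi /andP[x1 x2]; clear -v12 ab1 ab2 x1 x2; split_ifs.
- by move=> xi x1; clear -v12 ab1 ab2 x1; split_ifs.
Qed.

End Existence.

(** * Location of the waves *)

(** A cut point may be ignored, since every function is measurable on a
    singleton.  This covers the unspecified value of a profile at a shock. *)
Lemma measurable_fun_cut (R : realType) (D : set R) (f : R -> R) (a : R) :
  measurable D ->
  measurable_fun (D `&` `]-oo, a[) f -> measurable_fun (D `&` `]a, +oo[) f ->
  measurable_fun D f.
Proof.
move=> mD f1 f2.
apply: (@measurable_funS _ _ _ _
  ((D `&` `]-oo, a[) `|` ([set a] `|` (D `&` `]a, +oo[)))).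
- by apply: measurableU; [|apply: measurableU]; rewrite ?set_itv1//; exact: measurableI.
- move=> x Dx; have [xa|ax|->] := ltgtP x a.
  + by left; split=> //=; rewrite in_itv.
  + by right; right; split=> //=; rewrite in_itv/= andbT.
  + by right; left.
apply/measurable_funU; [exact: measurableI|apply: measurableU => //; exact: measurableI|].
split=> //; apply/measurable_funU => //; first exact: measurableI.
by split=> //; exact: measurable_fun_set1.
Qed.

Lemma measurable_fun_piece (R : realType) (D : set R) (f g : R -> R) :
  measurable D -> measurable_fun setT g -> (forall x, D x -> f x = g x) ->
  measurable_fun D f.
Proof.
move=> mD mg fg; apply: (eq_measurable_fun g).
  by move=> x; rewrite inE => /fg.
exact: measurable_funTS.
Qed.

Definition max_sound_speed (R : realType) (eps m : R) : R :=
  Num.sqrt eps * m * expR (m / 2).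

Section Localization.
Variables (R : realType) (eps m : R).
Hypothesis eps0 : 0 < eps.

Let kappa := max_sound_speed eps m.

Lemma sound_speed_bound (X : R * R) : 0 <= X.2 <= m ->
  X.1 - kappa <= lambda1 eps X <= X.1 /\ X.1 <= lambda2 eps X <= X.1 + kappa.
Proof.
move=> /andP[X0 Xm]; rewrite lambda1E ?lambda2E ?(ltW eps0)//.
have d0 : 0 < Num.sqrt eps by rewrite sqrtr_gt0.
have E0 := expR_gt0 (X.2 / 2).
have Em : expR (X.2 / 2) <= expR (m / 2) by rewrite ler_expR; lra.
have c0 : 0 <= Num.sqrt eps * X.2 * expR (X.2 / 2) by rewrite !mulr_ge0// ltW.
have : Num.sqrt eps * X.2 * expR (X.2 / 2) <= kappa.
  by rewrite /kappa /max_sound_speed -!mulrA ler_pM2l// ler_pM// ltW.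
lra.
Qed.

(** The mean value theorem on the curve that carries the fan. *)
Lemma curve_variation (slope : R -> R) (lambda : R * R -> R) (U V : R * R)
    (W : R -> R * R) :
  fan eps lambda slope U V W -> 0 <= U.2 <= m -> 0 <= V.2 <= m ->
  (forall r, 0 < r -> `|slope r| = Num.sqrt eps * expR (r / 2)) ->
  `|U.1 - V.1| <= kappa.
Proof.
move=> [[ab _] [Wa Wb] _ _ [g [cg dg Wg]]] Um Vm slopeE.
have -> : U.1 = g U.2 by rewrite -Wa Wg// lexx ltW.
have -> : V.1 = g V.2 by rewrite -Wb Wg// lexx ltW.
have d0 : 0 < Num.sqrt eps by rewrite sqrtr_gt0.
have key x y : 0 <= x -> x < y -> y <= m -> `|g x - g y| <= kappa.
  move=> x0 xy ym.
  have [z||c] := @MVT _ g slope x y xy _ _.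
  - by rewrite in_itv/= => /andP[xz _]; apply: dg; lra.
  - apply: (continuous_subspaceW _ cg) => w /=; rewrite !in_itv/= andbT => /andP[xz _]; lra.
  rewrite in_itv/= => /andP[xc cy] e.
  rewrite distrC e normrM slopeE; last lra.
  rewrite /kappa /max_sound_speed -!mulrA ler_pM2l// mulrC ler_pM ?expR_ge0//.
    by rewrite ger0_norm; lra.
  by rewrite ler_expR; lra.
case/andP: Um => U0 Um; case/andP: Vm => V0 Vm.
have [UV|VU|->] := ltgtP U.2 V.2.
- exact: key.
- by rewrite distrC; exact: key.
- by rewrite subrr normr0 /kappa /max_sound_speed !mulr_ge0 ?expR_ge0//; lra.
Qed.

Lemma rarefaction1_location (U V : R * R) W : U.2 <= m -> 0 <= V.2 ->
  rarefaction1 eps U V W ->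
  [/\ V.2 < U.2, `|U.1 - V.1| <= kappa &
      forall xi, lambda1 eps U <= xi <= lambda1 eps V ->
        0 <= (W xi).2 <= m /\ xi <= (W xi).1 <= xi + kappa].
Proof.
move=> Um V0 [fanW decr]; have [[ab _] [Wa Wb] lamW _ _] := fanW.
have VU : V.2 < U.2 by rewrite -Wa -[X in X.2 < _]Wb; exact: decr.
split=> //.
  apply: (curve_variation fanW); [lra|lra|] => r r0.
  by rewrite normrN curve_slopeE ?(ltW eps0)// ger0_norm// mulr_ge0 ?expR_ge0.
move=> xi /andP[x1 x2].
have W0 : 0 <= (W xi).2 <= m.
  apply/andP; split.
    move: x2; rewrite le_eqVlt => /predU1P[->|x2]; first by rewrite Wb.
    by apply: le_trans V0 _; rewrite -Wb ltW// decr.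
  move: x1; rewrite le_eqVlt => /predU1P[<-|x1]; first by rewrite Wa.
  by apply: le_trans Um; rewrite -Wa ltW// decr.
split=> //; have [+ _] := sound_speed_bound W0.
by rewrite lamW ?x1 ?x2//; lra.
Qed.

Lemma rarefaction2_location (U V : R * R) W : 0 <= U.2 -> V.2 <= m ->
  rarefaction2 eps U V W ->
  [/\ U.2 < V.2, `|U.1 - V.1| <= kappa &
      forall xi, lambda2 eps U <= xi <= lambda2 eps V ->
        0 <= (W xi).2 <= m /\ xi - kappa <= (W xi).1 <= xi].
Proof.
move=> U0 Vm [fanW incr]; have [[ab _] [Wa Wb] lamW _ _] := fanW.
have UV : U.2 < V.2 by rewrite -Wb -[X in X.2 < _]Wa; exact: incr.
split=> //.
  apply: (curve_variation fanW); [lra|lra|] => r r0.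
  by rewrite curve_slopeE ?(ltW eps0)// ger0_norm// mulr_ge0 ?expR_ge0.
move=> xi /andP[x1 x2].
have W0 : 0 <= (W xi).2 <= m.
  apply/andP; split.
    move: x1; rewrite le_eqVlt => /predU1P[<-|x1]; first by rewrite Wa.
    by apply: le_trans U0 _; rewrite -Wa ltW// incr.
  move: x2; rewrite le_eqVlt => /predU1P[->|x2]; first by rewrite Wb.
  by apply: le_trans Vm; rewrite -Wb ltW// incr.
split=> //; have [_ +] := sound_speed_bound W0.
by rewrite lamW ?x1 ?x2//; lra.
Qed.

Lemma fan_measurable (lambda : R * R -> R) slope (U V : R * R) W (h : R * R -> R)
    (D : set R) :
  fan eps lambda slope U V W -> continuous h ->
  measurable D -> (forall xi, D xi -> lambda U <= xi <= lambda V) ->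
  measurable_fun D (h \o W).
Proof.
move=> [[_ cW] _ _ _ _] ch mD DE.
apply: (@measurable_funS _ _ _ _ `[lambda U, lambda V]%classic) => //.
apply: subspace_continuous_measurable_fun => //.
by apply: within_continuous_comp cW => x _; exact: ch.
Qed.

Lemma profile_measurable (Ul Ur : R * R) W (h : R * R -> R) :
  continuous h -> riemann_profile eps Ul Ur W -> measurable_fun setT (h \o W).
Proof.
move=> ch; have cst_piece D X : measurable D -> (forall xi, D xi -> W xi = X) ->
    measurable_fun D (h \o W).
  move=> mD WX; apply: (@measurable_fun_piece _ _ _ (cst (h X))) => //.
  by move=> xi /WX /= ->.
have mcut : forall (D : set R) a, measurable D ->
    measurable (D `&` `]-oo, a[) /\ measurable (D `&` `]a, +oo[).
  by move=> D a mD; split; exact: measurableI.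
case.
- by move=> _ _ WE; apply: cst_piece => // xi _; exact: WE.
- move=> M s _ _ _ [fanW _] [_ _ _ /andP[Ms _]] WL WM WR.
  apply: (measurable_fun_cut (a := s)) => //; last first.
    apply: (cst_piece _ Ur); first exact: (mcut _ _ _).2.
    by move=> xi [_]; rewrite /= in_itv/= andbT => /WR.
  set D := _ `&` _; have mD : measurable D by exact: (mcut _ _ _).1.
  apply: (measurable_fun_cut (a := lambda1 eps Ul)) => //.
    apply: (cst_piece _ Ul); first exact: (mcut _ _ _).1.
    by move=> xi [_]; rewrite /= in_itv/= => /WL.
  set E := _ `&` _; have mE : measurable E by exact: (mcut _ _ _).2.
  apply: (measurable_fun_cut (a := lambda1 eps M)) => //.
    apply: (fan_measurable fanW ch); first exact: (mcut _ _ _).1.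
    by move=> xi [[_ +]]; rewrite /= !in_itv/= andbT => /ltW -> /ltW ->.
  apply: (cst_piece _ M); first exact: (mcut _ _ _).2.
  move=> xi [[[_ +]]]; rewrite /= !in_itv/= !andbT => xs _ xM.
  by apply: WM; rewrite xM.
- move=> M s _ _ _ [_ _ _ /andP[_ sM]] [fanW _] WL WM WR.
  apply: (measurable_fun_cut (a := s)) => //.
    apply: (cst_piece _ Ul); first exact: (mcut _ _ _).1.
    by move=> xi [_]; rewrite /= in_itv/= => /WL.
  set D := _ `&` _; have mD : measurable D by exact: (mcut _ _ _).2.
  apply: (measurable_fun_cut (a := lambda2 eps M)) => //.
    apply: (cst_piece _ M); first exact: (mcut _ _ _).1.
    move=> xi [[_ +]]; rewrite /= !in_itv/= !andbT => xs xM.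
    by apply: WM; rewrite xs.
  set E := _ `&` _; have mE : measurable E by exact: (mcut _ _ _).2.
  apply: (measurable_fun_cut (a := lambda2 eps Ur)) => //.
    apply: (fan_measurable fanW ch); first exact: (mcut _ _ _).1.
    by move=> xi [[_ +]]; rewrite /= !in_itv/= andbT => /ltW -> /ltW ->.
  apply: (cst_piece _ Ur); first exact: (mcut _ _ _).2.
  by move=> xi [_]; rewrite /= in_itv/= andbT => /WR.
- move=> _ v12 [fan1 _] [fan2 _] WL WM WR.
  set v1 := vacuum1 _ _ in v12 fan1 WM; set v2 := vacuum2 _ _ in v12 fan2 WM.
  have l1 : lambda1 eps (v1, 0) = v1.
    by rewrite lambda1E ?(ltW eps0)//= mulr0 mul0r subr0.
  have l2 : lambda2 eps (v2, 0) = v2.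
    by rewrite lambda2E ?(ltW eps0)//= mulr0 mul0r addr0.
  apply: (measurable_fun_cut (a := lambda1 eps Ul)) => //.
    apply: (cst_piece _ Ul); first exact: (mcut _ _ _).1.
    by move=> xi [_]; rewrite /= in_itv/= => /WL.
  set D := _ `&` _; have mD : measurable D by exact: (mcut _ _ _).2.
  apply: (measurable_fun_cut (a := v1)) => //.
    apply: (fan_measurable fan1 ch); first exact: (mcut _ _ _).1.
    by move=> xi [[_ +]]; rewrite /= !in_itv/= andbT l1 => /ltW -> /ltW ->.
  set E := _ `&` _; have mE : measurable E by exact: (mcut _ _ _).2.
  apply: (measurable_fun_cut (a := v2)) => //.
    apply: (@measurable_fun_piece _ _ _ (fun xi => h (xi, 0))).
    + exact: (mcut _ _ _).1.
    + apply: continuous_measurable_fun => xi; apply: (continuous_comp (g := h)).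
        exact: (cvg_pair cvg_id (cvg_cst (0 : R))).
      exact: ch.
    + move=> xi [[_ +]]; rewrite /= !in_itv/= !andbT => x1 x2.
      by rewrite WM// x1.
  set F := _ `&` _; have mF : measurable F by exact: (mcut _ _ _).2.
  apply: (measurable_fun_cut (a := lambda2 eps Ur)) => //.
    apply: (fan_measurable fan2 ch); first exact: (mcut _ _ _).1.
    by move=> xi [[_ +]]; rewrite /= !in_itv/= andbT l2 => /ltW -> /ltW ->.
  apply: (cst_piece _ Ur); first exact: (mcut _ _ _).2.
  by move=> xi [_]; rewrite /= in_itv/= andbT => /WR.
Qed.

(** Each wave lies within twice the sound speed of Ul.1 or of Ur.1: once
    for the velocity change across the wave, and once for the difference between
    velocities and characteristic speeds.  The exceptional value s is the
    speed of the shock, if there is one. *)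
Lemma riemann_profile_location (Ul Ur : R * R) W :
  0 < Ul.2 <= m -> 0 < Ur.2 <= m -> riemann_profile eps Ul Ur W ->
  let B := `|Ul.1| + `|Ur.1| + 3 * kappa in
  [/\ forall xi, xi < Ul.1 - 2 * kappa -> W xi = Ul,
      forall xi, Ur.1 + 2 * kappa < xi -> W xi = Ur,
      forall xi, Ul.1 + 2 * kappa < xi < Ur.1 - 2 * kappa -> W xi = (xi, 0) &
      exists s, forall xi, xi <> s ->
        - B <= (W xi).1 <= B /\ 0 <= (W xi).2 <= m].
Proof.
move=> /andP[l0 lm] /andP[r0 rm] + B.
have m0 : 0 <= m by lra.
have k0 : 0 <= kappa by rewrite /kappa /max_sound_speed !mulr_ge0 ?expR_ge0.
have nl : `|Ul.1| <= `|Ul.1| := lexx _; have nr : `|Ur.1| <= `|Ur.1| := lexx _.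
move: nl nr; rewrite {1}ler_norml {1}ler_norml => nl nr.
have [Ul1 Ul2] : Ul.1 - kappa <= lambda1 eps Ul <= Ul.1 /\
    Ul.1 <= lambda2 eps Ul <= Ul.1 + kappa.
  by apply: sound_speed_bound; lra.
have [Ur1 Ur2] : Ur.1 - kappa <= lambda1 eps Ur <= Ur.1 /\
    Ur.1 <= lambda2 eps Ur <= Ur.1 + kappa.
  by apply: sound_speed_bound; lra.
case=> [u12 r12 WE|M s u12 r12 M0 rar sh WL WM WR|M s u12 r12 M0 sh rar WL WM WR|].
- split; first by [].
  + by move=> xi _; rewrite WE; apply: injective_projections.
  + by move=> xi ?; exfalso; lra.
  + by exists 0 => xi _; rewrite WE /B; lra.
- have [MU UM loc] := rarefaction1_location lm M0 rar.
  move: UM; rewrite ler_norml => UM.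
  have [M1 M2] : M.1 - kappa <= lambda1 eps M <= M.1 /\
      M.1 <= lambda2 eps M <= M.1 + kappa.
    by apply: sound_speed_bound; lra.
  case: sh => _ _ _ sM.
  split.
  + by move=> xi xl; apply: WL; lra.
  + by move=> xi xr; apply: WR; lra.
  + by move=> xi ?; exfalso; lra.
  + exists s => xi /eqP xs.
    have [xa|ax] := ltP xi (lambda1 eps Ul); first by rewrite WL// /B; lra.
    have [xb|bx] := leP xi (lambda1 eps M).
      by have [] := loc xi _; [lra|rewrite /B; lra].
    move: xs; rewrite neq_lt => /orP[xs|sx]; last by rewrite WR// /B; lra.
    by rewrite WM ?bx// /B; lra.
- have [MU UM loc] := rarefaction2_location M0 rm rar.
  move: UM; rewrite ler_norml => UM.
  have [M1 M2] : M.1 - kappa <= lambda1 eps M <= M.1 /\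
      M.1 <= lambda2 eps M <= M.1 + kappa.
    by apply: sound_speed_bound; lra.
  case: sh => _ _ _ sM.
  split.
  + by move=> xi xl; apply: WL; lra.
  + by move=> xi xr; apply: WR; lra.
  + by move=> xi ?; exfalso; lra.
  + exists s => xi /eqP xs.
    have [xa|ax] := ltP (lambda2 eps Ur) xi; first by rewrite WR// /B; lra.
    have [xb|bx] := leP (lambda2 eps M) xi.
      by have [] := loc xi _; [lra|rewrite /B; lra].
    move: xs; rewrite neq_lt => /orP[xs|sx]; first by rewrite WL// /B; lra.
    by rewrite WM ?bx ?sx// /B; lra.
- move=> u12 v12 rar1 rar2 WL WM WR.
  have [_ U1 loc1] := rarefaction1_location (V := (vacuum1 eps Ul, 0)) lm (lexx _) rar1.
  have [_ U2 loc2] := rarefaction2_location (U := (vacuum2 eps Ur, 0)) (lexx _) rm rar2.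
  have l1 : lambda1 eps (vacuum1 eps Ul, 0) = vacuum1 eps Ul.
    by rewrite lambda1E ?(ltW eps0)//= mulr0 mul0r subr0.
  have l2 : lambda2 eps (vacuum2 eps Ur, 0) = vacuum2 eps Ur.
    by rewrite lambda2E ?(ltW eps0)//= mulr0 mul0r addr0.
  rewrite l1 in loc1; rewrite l2 in loc2; move: U1 U2; rewrite !ler_norml/=.
  move: (vacuum1 eps Ul) (vacuum2 eps Ur) v12 WM loc1 loc2 
    => v1 v2 v12 WM loc1 loc2 U1 U2.
  split.
  + by move=> xi xl; apply: WL; lra.
  + by move=> xi xr; apply: WR; lra.
  + by move=> xi x12; apply: WM; lra.
  + exists v1 => xi /eqP xs.
    have [xa|ax] := ltP xi (lambda1 eps Ul); first by rewrite WL// /B; lra.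
    have [xb|bx] := leP xi v1.
      by have [] := loc1 xi _; [lra|rewrite /B; lra].
    have [xc|cx] := ltP xi v2; first by rewrite WM ?bx// /B/=; lra.
    have [xd|dx] := leP xi (lambda2 eps Ur).
      by have [] := loc2 xi _; [lra|rewrite /B; lra].
    by rewrite WR// /B; lra.
Qed.

End Localization.

(** * Convergence of Riemann solutions *)

Lemma ray_profile_measurable (R : realType) (G : R -> R) (g : R -> R -> R) :
  measurable_fun setT G -> (forall x t, 0 < t -> g x t = G (x / t)) ->
  measurable_fun half_plane (fun z : R * R => g z.1 z.2).
Proof.
move=> mG gG; have mH := @measurable_half_plane R.
apply: (eq_measurable_fun (fun z : R * R => G (z.1 / z.2))).
  by move=> z; rewrite inE => /gG ->.
apply: measurableT_comp => //; apply: measurable_funM.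
  by apply: measurable_funTS; exact: measurable_fst.
have mV : measurable_fun (`]0, +oo[%classic : set R) (fun t : R => t^-1).
  apply: open_continuous_measurable_fun; first exact: interval_open.
  move=> t; rewrite inE/= in_itv/= andbT => t0.
  by apply: inv_continuous; exact: lt0r_neq0.
have m2 : measurable_fun (@half_plane R) (snd : R * R -> R).
  by apply: measurable_funTS; exact: measurable_snd.
apply: (measurable_comp _ _ mV m2) => //.
by move=> _ [z z0 <-]; rewrite /= in_itv/= andbT.
Qed.

Lemma measurable_fun_three_pieces (R : realType) (a b : R) (F1 F2 F3 : R -> R) :
  measurable_fun setT F1 -> measurable_fun setT F2 -> measurable_fun setT F3 ->
  measurable_fun setT
    (fun x : R => if x < a then F1 x else if x <= b then F2 x else F3 x).
Proof.
move=> m1 m2 m3; apply: measurable_fun_ifT => //; first exact: measurable_fun_ltr.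
by apply: measurable_fun_ifT => //; exact: measurable_fun_ler.
Qed.

Lemma near_max_sound_speed (R : realType) (m e : R) : 0 < e ->
  \forall eps \near 0^'+, 0 < eps /\ max_sound_speed eps m < e.
Proof.
move=> e0.
have c0 : max_sound_speed 0 m = 0 by rewrite /max_sound_speed sqrtr0 !mul0r.
have c : max_sound_speed eps m @[eps --> (0 : R)^'+] --> max_sound_speed 0 m.
  apply: cvg_at_right_filter; rewrite /max_sound_speed.
  by do 2 (apply: cvgMl => //); exact: sqrt_continuous.
rewrite c0 in c.
near=> eps; split; first by near: eps; exact: nbhs_right_gt.
by near: eps; apply: (cvgr_lt _ c).
Unshelve. all: end_near.
Qed.

(** The observable h stands for the velocity or for the density. *)
Lemma riemann_distribution_cvg (R : realType) (h : R * R -> R)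
    (Ul Ur : R * R) (f : R -> R -> R -> R) (g : R -> R -> R) (M : R) :
  continuous h -> (forall X, `|h X| <= `|X.1| + `|X.2|) ->
  0 < Ul.2 -> 0 < Ur.2 ->
  (\forall eps \near 0^'+, exists2 W, riemann_profile eps Ul Ur W &
     forall x t, 0 < t -> f eps x t = h (W (x / t))) ->
  measurable_fun half_plane (fun z : R * R => g z.1 z.2) ->
  (forall x t, 0 < t -> `|g x t| <= M) ->
  (forall x t, 0 < t ->
     [/\ x / t < Ul.1 -> g x t = h Ul,
         Ul.1 < x / t < Ur.1 -> g x t = h (x / t, 0) &
         Ur.1 < x / t -> g x t = h Ur]) ->
  distribution_cvg f g.
Proof.
move=> ch hle l0 r0 fW mg gM gE.
pose m := Ul.2 + Ur.2.
have lm : 0 < Ul.2 <= m by rewrite /m; lra.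
have rm : 0 < Ur.2 <= m by rewrite /m; lra.
pose B := `|Ul.1| + `|Ur.1| + 3 + m.
have B0 : 0 <= B by rewrite /B !addr_ge0// /m; lra.
have M0 : 0 <= M by apply: le_trans (gM 0 1 ltr01).
apply: (@ray_profile_cvg _ Ul.1 Ur.1 (B + M)) => //.
- near=> eps.
  have [e0 k1] : 0 < eps /\ max_sound_speed eps m < 1.
    by near: eps; exact: (near_max_sound_speed m).
  have [W rW fE] : exists2 W, riemann_profile eps Ul Ur W &
     forall x t, 0 < t -> f eps x t = h (W (x / t)) by near: eps.
  split.
    apply: (ray_profile_measurable (G := h \o W)) => //.
    exact: (profile_measurable e0 ch rW).
  have [_ _ _ [s Ws]] := riemann_profile_location e0 lm rm rW.
  have hB xi : xi <> s -> `|h (W xi)| <= B + M.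
    move=> /Ws[W1 W2]; apply: le_trans (hle _) _.
    have : `|(W xi).1| <= `|Ul.1| + `|Ur.1| + 3 * max_sound_speed eps m.
      by rewrite ler_norml.
    have : `|(W xi).2| <= m by rewrite ger0_norm; lra.
    by rewrite /B; lra.
  exists s, (B + M + `|h (W s)|) => x t t0; rewrite fE//.
  have [xs|/eqP xs] := eqVneq (x / t) s.
    split; first by rewrite xs lerDr; lra.
    by case; rewrite -xs divfK// lt0r_neq0.
  by have := hB _ xs; split; last by []; rewrite ler_wpDr.
- by move=> x t t0; apply: le_trans (gM _ _ t0) _; lra.
- move=> x t t0 xl xr; have [gl gm gr] := gE x t t0.
  have neq v : x <> v * t -> x / t != v.
    by move=> xv; apply/eqP => e; apply: xv; rewrite -e divfK// lt0r_neq0.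
  move/neq: xl; move/neq: xr => xr xl.
  pose e := Num.min `|x / t - Ul.1| `|x / t - Ur.1| / 2.
  have e0 : 0 < e by rewrite divr_gt0// lt_min !normr_gt0 !subr_eq0 xl xr.
  have el : 2 * e <= `|x / t - Ul.1| by rewrite /e mulrC divfK// ge_min lexx.
  have er : 2 * e <= `|x / t - Ur.1| by rewrite /e mulrC divfK// ge_min lexx orbT.
  near=> eps.
  have [eps0 ke] : 0 < eps /\ max_sound_speed eps m < e.
    by near: eps; exact: (near_max_sound_speed m).
  have [W rW fE] : exists2 W, riemann_profile eps Ul Ur W &
     forall x t, 0 < t -> f eps x t = h (W (x / t)) by near: eps.
  have [WL WR WM _] := riemann_profile_location eps0 lm rm rW.
  rewrite fE//; move: xl; rewrite neq_lt => /orP[xl|xl].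
    rewrite gl// WL//; move: el; rewrite ltr0_norm; lra.
  move: el; rewrite gtr0_norm ?subr_gt0// => el.
  move: xr; rewrite neq_lt => /orP[xr|xr].
    rewrite gm ?xl// WM//; move: er; rewrite ltr0_norm; lra.
  rewrite gr// WR//; move: er; rewrite gtr0_norm; lra.
Unshelve. all: end_near.
Qed.

Theorem mainTheorem4 (R : realType) (ul ur rl rr : R)
    (hl : 0 < rl) (hr : 0 < rr) (hu : ul <= ur) :
  (\forall eps \near 0^'+, exists u rho : R -> R -> R,
     riemann_solution eps (ul, rl) (ur, rr) u rho) /\
  (forall u rho : R -> R -> R -> R,
     (\forall eps \near 0^'+,
        riemann_solution eps (ul, rl) (ur, rr) (u eps) (rho eps)) ->
     (ul = ur ->
        distribution_cvg u (fun _ _ => ul) /\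
        distribution_cvg rho (jump_density ul rl rr)) /\
     (ul < ur ->
        distribution_cvg u (fan_velocity ul ur) /\
        distribution_cvg rho (vacuum_density ul ur rl rr))).
Proof.
split.
  have E1 := expR_gt0 (rl / 2); have E2 := expR_gt0 (rr / 2).
  pose S := expR (rl / 2) + expR (rr / 2).
  have profile : \forall eps \near 0^'+,
      exists W, riemann_profile eps (ul, rl) (ur, rr) W.
    have [ulr|ulr|<-] := ltgtP ul ur; last first.
    - near=> eps; have e0 : 0 < eps by near: eps; exact: nbhs_right_gt.
      have [rlr|rrl|<-] := ltgtP rl rr.
      + exact: shock_rarefaction_exists.
      + exact: rarefaction_shock_exists.
      + by exists (fun=> (ul, rl)); exact: riemann_constant.
    - by exfalso; lra.
    (* The vacuum velocities differ from ul and ur by less than 2 sqrt(eps) S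
       in total, and sqrt(eps) is at most [max_sound_speed eps 1]. *)
    - pose e := (ur - ul) / (2 * S).
      have e_gt0 : 0 < e by rewrite /e divr_gt0 /S; lra.
      near=> eps.
      have [e0 ke] : 0 < eps /\ max_sound_speed eps 1 < e.
        by near: eps; exact: (near_max_sound_speed 1).
      apply: vacuum_exists => //; rewrite vacuum1E ?vacuum2E ?(ltW e0)//=.
      have d0 : 0 < Num.sqrt eps by rewrite sqrtr_gt0.
      have de : Num.sqrt eps < e.
        have Eh : 1 < expR (1 / 2) :> R by rewrite expR_gt1; lra.
        by apply: le_lt_trans ke; rewrite /max_sound_speed; nra.
      have : Num.sqrt eps * (2 * S) < ur - ul.
        by rewrite -ltr_pdivlMr//; rewrite /S; lra.
      by rewrite /S; nra.
  apply: filterS profile => eps [W rW].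
  by exists (fun x t => (W (x / t)).1), (fun x t => (W (x / t)).2), W.
move=> u rho sol.
have solu : \forall eps \near 0^'+,
    exists2 W, riemann_profile eps (ul, rl) (ur, rr) W &
      forall x t, 0 < t -> u eps x t = (W (x / t)).1.
  by apply: filterS sol => eps [W rW WE]; exists W => // x t /WE-/(_ x)[].
have solr : \forall eps \near 0^'+,
    exists2 W, riemann_profile eps (ul, rl) (ur, rr) W &
      forall x t, 0 < t -> rho eps x t = (W (x / t)).2.
  by apply: filterS sol => eps [W rW WE]; exists W => // x t /WE-/(_ x)[].
have c1 : continuous (fst : R * R -> R) by move=> z; exact: cvg_fst.
have c2 : continuous (snd : R * R -> R) by move=> z; exact: cvg_snd.
have n1 (X : R * R) : `|X.1| <= `|X.1| + `|X.2| by rewrite lerDl.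
have n2 (X : R * R) : `|X.2| <= `|X.1| + `|X.2| by rewrite lerDr.
have ltE (v x t : R) : 0 < t -> (x < v * t) = (x / t < v).
  by move=> t0; rewrite ltr_pdivrMr.
have leE (v x t : R) : 0 < t -> (x <= v * t) = (x / t <= v).
  by move=> t0; rewrite ler_pdivrMr.
split=> [uE|ulr].
- have uconst : distribution_cvg u (fun _ _ => ul).
    apply: (riemann_distribution_cvg (M := `|ul|) c1 n1 _ _ solu) => //=.
    by move=> x t t0; rewrite -uE; split=> // ?; exfalso; lra.
  split=> //.
  apply: (riemann_distribution_cvg (M := rl + rr) c2 n2 _ _ solr) => //=.
  + apply: (ray_profile_measurable (G := fun xi =>
      if xi < ul then rl else if xi <= ul then rr else rr)).
      by apply: measurable_fun_three_pieces.
    by move=> x t t0; rewrite /jump_density ltE//; case: ltP => //; case: ifP.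
  + move=> x t t0; rewrite /jump_density; case: ifP => _; rewrite gtr0_norm//; lra.
  + move=> x t t0; rewrite /jump_density ltE// -uE; split.
    * by move=> ->.
    * by move=> ?; exfalso; lra.
    * by move=> xu; rewrite ltNge ltW.
- split.
  + apply: (riemann_distribution_cvg (M := `|ul| + `|ur|) c1 n1 _ _ solu) => //=.
    * apply: (ray_profile_measurable (G := fun xi =>
        if xi < ul then ul else if xi <= ur then xi else ur)).
        by apply: (@measurable_fun_three_pieces _ _ _ (cst ul) id (cst ur)).
      by move=> x t t0; rewrite /fan_velocity ltE// leE.
    * move=> x t t0; rewrite /fan_velocity ltE// leE//.
      have nl := normr_ge0 ul; have nr := normr_ge0 ur.
      case: ltP => [_|x1]; first by rewrite lerDl.
      case: (leP (x / t) ur) => [x2|_]; last by rewrite lerDr.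
      have := ler_norm ur; have : - ul <= `|ul| by rewrite -normrN ler_norm.
      by rewrite ler_norml; lra.
    * move=> x t t0; rewrite /fan_velocity ltE// leE//; split.
      - by move=> ->.
      - by move=> /andP[x1 x2]; rewrite ltNge ltW//= ltW.
      - by move=> xu; rewrite ltNge ltW ?(lt_trans ulr)//= leNgt xu.
  + apply: (riemann_distribution_cvg (M := rl + rr) c2 n2 _ _ solr) => //=.
    * apply: (ray_profile_measurable (G := fun xi =>
        if xi < ul then rl else if xi <= ur then 0 else rr)).
        by apply: measurable_fun_three_pieces.
      by move=> x t t0; rewrite /vacuum_density ltE// leE.
    * move=> x t t0; rewrite /vacuum_density.
      by case: ifP => _; [|case: ifP => _]; rewrite ger0_norm//; lra.
    * move=> x t t0; rewrite /vacuum_density ltE// leE//; split.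
      - by move=> ->.
      - by move=> /andP[x1 x2]; rewrite ltNge ltW//= ltW.
      - by move=> xu; rewrite ltNge ltW ?(lt_trans ulr)//= leNgt xu.
Unshelve. all: end_near.
Qed.
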